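(* Let $p$ be a prime and let $E/\mathbb{Q}$ be an elliptic curve with additive reduction at $p$. Then the $p$-adic Mazur--Tate elements $\theta_{n,E}$ satisfy $$\lambda(\theta_{n,E})\ge p^{n-1}$$ for all integers $n\ge1$.
   Context: **The form.** For an elliptic curve $E/\mathbb{Q}$ of conductor $N_E$, $f_E\in S_2(\Gamma_0(N_E))$ is the normalized eigenform with the same $L$-function as $E$, and $\theta_{n,E}:=\theta_{n,f_E}$ is defined as follows, with $f=f_E$. **Groups.** If $p$ is odd, put $m(n)=n+1$ and let $K_n$ be the unique subfield of $\mathbb{Q}(\mu_{p^{n+1}})$ of degree $p^n$ over $\mathbb{Q}$. If $p=2$, put $m(n)=n+2$ and let $K_n$ be the subfield of $\mathbb{Q}(\mu_{2^{n+2}})$ fixed by complex conjugation $\sigma_{-1}$. In both cases $\mathcal{G}_n=\mathrm{Gal}(K_n/\mathbb{Q})$ is cyclic of order $p^n$. For $a\in(\mathbb{Z}/p^{m(n)}\mathbb{Z})^\times$, $\sigma_a\in\mathrm{Gal}(\mathbb{Q}(\mu_{p^{m(n)}})/\mathbb{Q})$ is the automorphism with $\sigma_a(\zeta)=\zeta^a$ for all $\zeta\in\mu_{p^{m(n)}}$, and $\pi_n:\mathrm{Gal}(\mathbb{Q}(\mu_{p^{m(n)}})/\mathbb{Q})\to\mathcal{G}_n$ is restriction. **Modular symbols.** The modular symbol $\varphi_f:\mathrm{Div}^0(\mathbb{P}^1(\mathbb{Q}))\to\mathbb{C}$ of the weight-two form $f$ is the homomorphism given by $$\varphi_f(\{r\}-\{s\})=2\pi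 i\int_s^r f(z)\,dz.$$ Let $\iota=\begin{pmatrix}-1&0\\0&1\end{pmatrix}$ act on such homomorphisms by $(\varphi|\iota)(D)=\varphi(\iota D)$ (so $\iota$ sends $r\in\mathbb{P}^1(\mathbb{Q})$ to $-r$), and write $\varphi_f=\varphi_f^++\varphi_f^-$ with $\varphi_f^\pm|\iota=\pm\varphi_f^\pm$. **Cohomological period.** $\Omega_f^+\in\mathbb{C}^\times$ is a number such that $\varphi_f^+/\Omega_f^+$ takes values in $\mathbb{Q}$ and the maximum over all $D\in\mathrm{Div}^0(\mathbb{P}^1(\mathbb{Q}))$ of the $p$-adic absolute value of $\varphi_f^+(D)/\Omega_f^+$ equals $1$. It is determined up to multiplication by a rational number that is a $p$-adic unit. **Mazur--Tate elements.** The $p$-adic Mazur--Tate element of level $n$ is $$\theta_{n,f}=\frac{1}{\Omega_f^+}\sum_{a\in(\mathbb{Z}/p^{m(n)}\mathbb{Z})^\times}\varphi_f\big(\{\infty\}-\{a/p^{m(n)}\}\big)\,\pi_n(\sigma_a),$$ which lies in $\mathbb{Z}_p[\mathcal{G}_n]$. **Iwasawa invariants.** Choose a generator $\gamma_n$ of $\mathcal{G}_n$ and write $F\in\mathbb{Z}_p[\mathcal{G}_n]$ uniquely as $F=\sum_{i=0}^{p^n-1}a_iX^i$ with $X=\gamma_n-1$ and $a_i\in\mathbb{Z}_p$. If $F\ne0$, $\mu(F)=\min_i\mathrm{ord}_p(a_i)$ and $\lambda(F)=\min\{i:\mathrm{ord}_p(a_i)=\mu(F)\}$. If $F=0$, $\mu(F)=\lambda(F)=\infty$.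 These do not depend on the choice of $\gamma_n$. *)

(* Defs.v *)
From HB Require Import structures.
From mathcomp Require Import all_boot all_order all_algebra all_fingroup.
From mathcomp Require Import all_solvable all_field.
From mathcomp Require Import complex freeg.
From mathcomp Require Import all_classical all_reals all_analysis.

Set Implicit Arguments.
Unset Strict Implicit.
Unset Printing Implicit Defensive.

Import Order.TTheory GRing.Theory Num.Theory.
Import numFieldNormedType.Exports.
Local Open Scope ring_scope.
Local Open Scope complex_scope.
Local Open Scope classical_set_scope.

(* y^2 + a1 x y + a3 y = x^3 + a2 x^2 + a4 x + a6 *)
Record weierstrass (R : Type) := Weierstrass {
  wa1 : R; wa2 : R; wa3 : R; wa4 : R; wa6 : R }.

Definition wmap (R S : Type) (h : R -> S) (W : weierstrass R) : weierstrass S :=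
  Weierstrass (h (wa1 W)) (h (wa2 W)) (h (wa3 W)) (h (wa4 W)) (h (wa6 W)).

Definition wb2 (R : comNzRingType) (W : weierstrass R) : R :=
  wa1 W ^+ 2 + 4%:R * wa2 W.
Definition wb4 (R : comNzRingType) (W : weierstrass R) : R :=
  2%:R * wa4 W + wa1 W * wa3 W.
Definition wb6 (R : comNzRingType) (W : weierstrass R) : R :=
  wa3 W ^+ 2 + 4%:R * wa6 W.
Definition wb8 (R : comNzRingType) (W : weierstrass R) : R :=
  wa1 W ^+ 2 * wa6 W + 4%:R * wa2 W * wa6 W - wa1 W * wa3 W * wa4 W
  + wa2 W * wa3 W ^+ 2 - wa4 W ^+ 2.
Definition wdisc (R : comNzRingType) (W : weierstrass R) : R :=
  - wb2 W ^+ 2 * wb8 W - 8%:R * wb4 W ^+ 3 - 27%:R * wb6 W ^+ 2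
  + 9%:R * wb2 W * wb4 W * wb6 W.

Definition on_curve (R : comNzRingType) (W : weierstrass R) (P : R * R) : bool :=
  P.2 ^+ 2 + wa1 W * P.1 * P.2 + wa3 W * P.2
  == P.1 ^+ 3 + wa2 W * P.1 ^+ 2 + wa4 W * P.1 + wa6 W.

(* W' is obtained from W by x = u^2 x' + r, y = u^3 y' + s u^2 x' + t *)
Definition change_of_variables (F : fieldType) (W W' : weierstrass F)
    (u r s t : F) : Prop :=
  [/\ u * wa1 W' = wa1 W + 2%:R * s,
      u ^+ 2 * wa2 W' = wa2 W - s * wa1 W + 3%:R * r - s ^+ 2,
      u ^+ 3 * wa3 W' = wa3 W + r * wa1 W + 2%:R * t,
      u ^+ 4 * wa4 W' = wa4 W - s * wa3 W + 2%:R * r * wa2 W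
        - (t + r * s) * wa1 W + 3%:R * r ^+ 2 - 2%:R * s * t
    & u ^+ 6 * wa6 W' = wa6 W + r * wa4 W + r ^+ 2 * wa2 W + r ^+ 3
        - t * wa3 W - t ^+ 2 - r * t * wa1 W].

Definition integral_model (E : weierstrass rat) (M : weierstrass int) : Prop :=
  exists u r s t : rat, u != 0 /\
    change_of_variables E (wmap intr M) u r s t.

Definition global_minimal_model (E : weierstrass rat) (M : weierstrass int)
    : Prop :=
  integral_model E M /\
  forall l : nat, prime l ->
    forall M' : weierstrass int, integral_model E M' ->
      (logn l `|wdisc M|%N <= logn l `|wdisc M'|%N)%N.

(* The singular point of a singular Weierstrass cubic over a perfect field is
    unique, hence rational, so quantifying over 'F_l-points loses nothing; the
   point at infinity is never singular. *)

Definition reduction (M : weierstrass int) (l : nat) : weierstrass 'F_l :=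
  wmap intr M.

Definition singular_point (R : comNzRingType) (W : weierstrass R) (P : R * R)
    : bool :=
  [&& on_curve W P,
      wa1 W * P.2 == 3%:R * P.1 ^+ 2 + 2%:R * wa2 W * P.1 + wa4 W
    & 2%:R * P.2 + wa1 W * P.1 + wa3 W == 0].

(* At a singular point (x0, y0) the equation becomes
   Y^2 + a1 X Y - (a2 + 3 x0) X^2 = X^3 with X = x - x0 and Y = y - y0;
   the roots of the following polynomial are the slopes Y / X of the tangents. *)
Definition tangent_poly (R : comNzRingType) (W : weierstrass R) (P : R * R)
    : {poly R} :=
  'X^2 + wa1 W *: 'X - (wa2 W + 3%:R * P.1)%:P.

Definition good_reduction (M : weierstrass int) (l : nat) : bool :=
  [forall P : 'F_l * 'F_l, ~~ singular_point (reduction M l) P].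

(* a cusp: the two tangents at the singular point coincide *)
Definition additive_reduction (M : weierstrass int) (l : nat) : bool :=
  [exists P : 'F_l * 'F_l, singular_point (reduction M l) P &&
    [exists c : 'F_l, tangent_poly (reduction M l) P == ('X - c%:P) ^+ 2]].

(* a node whose two tangents are defined over 'F_l *)
Definition split_reduction (M : weierstrass int) (l : nat) : bool :=
  [exists P : 'F_l * 'F_l, singular_point (reduction M l) P &&
    [exists c : 'F_l, [exists d : 'F_l, (c != d) &&
      (tangent_poly (reduction M l) P == ('X - c%:P) * ('X - d%:P))]]].

(* The summand 1 is the point at infinity. *)
Definition trace_of_frobenius (M : weierstrass int) (l : nat) : int :=
  if good_reduction M l
  then l.+1%:Z - (#|[pred P | on_curve (reduction M l) P]| + 1)%N%:Z
  else if additive_reduction M l then 0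
  else if split_reduction M l then 1
  else -1.

(* coefficient of T^k in the power series 1 / (1 - a T + b T^2) *)
Fixpoint euler_coef (a b : int) (k : nat) : int :=
  if k is k1.+1 then
    a * euler_coef a b k1 - (if k1 is k2.+1 then b * euler_coef a b k2 else 0)
  else 1.

(* The coefficient of n^-s in the Euler product
   L(E, s) = \prod_l (1 - a_l l^-s + [good reduction at l] l^(1-2s))^-1. *)
Definition L_coef (M : weierstrass int) (n : nat) : int :=
  \prod_(l <- primes n)
    euler_coef (trace_of_frobenius M l)
      (if good_reduction M l then l%:Z else 0) (logn l n).

(* ord_P for a prime P of L above l; the value at 0 is irrelevant *)
Definition place_above (L : fieldType) (l : nat) (v : L -> int) : Prop :=
  [/\ forall x y, x != 0 -> y != 0 -> v (x * y) = v x + v y,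
      forall x y, x != 0 -> y != 0 -> x + y != 0 ->
        Num.min (v x) (v y) <= v (x + y),
      exists2 x, x != 0 & v x = 1
    & 0 < v l%:R].

(* The i-th ramification group, in the lower numbering: s x = x modulo
   P^(i+1) for every P-integral x.  Such an s stabilises P. *)
Definition ramification_group (L : splittingFieldType rat) (v : L -> int)
    (i : nat) : {set gal_of {:L}} :=
  finset (fun s : gal_of {:L} =>
    `[< forall x : L, x != 0 -> 0 <= v x ->
          s x = x \/ i.+1%:Z <= v (s x - x) >]).

(* Nonzero points of order dividing q, for q = 2 (P = -P) and for
   q = 3 (2 P = -P, i.e. x(P) is a root of the 3-division polynomial). *)
Definition torsion_point (R : comNzRingType) (W : weierstrass R) (q : nat)
    (P : R * R) : bool :=
  on_curve W P &&
  (if q == 2%N then 2%:R * P.2 + wa1 W * P.1 + wa3 W == 0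
   else 3%:R * P.1 ^+ 4 + wb2 W * P.1 ^+ 3 + 3%:R * wb4 W * P.1 ^+ 2
        + 3%:R * wb6 W * P.1 + wb8 W == 0).

(* The wild part of the conductor exponent at l,
     \sum_(i >= 1) |G_i| / |G_0| * dim (E[q] / E[q]^(G_i)),
   G_i the ramification groups of Q(E[q]) / Q at a place above l.  It does not
   depend on the prime q != l; q is 2 here, or 3 if l = 2.  T lists the
   q^2 - 1 nonzero points of E[q]. *)
Definition wild_exponent (M : weierstrass int) (l d : nat) : Prop :=
  let q := if l == 2%N then 3%N else 2%N in
  exists (L : splittingFieldType rat) (T : seq (L * L)) (v : L -> int) (k : nat),
    [/\ [/\ uniq T, size T = (q ^ 2).-1,
            all (torsion_point (wmap intr M) q) T
          & <<1 & unzip1 T ++ unzip2 T>>%VS = fullv],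
        place_above l v,
        forall i, (k <= i)%N -> ramification_group v i = [set 1%g]%SET
      & d%:R = \sum_(1 <= i < k)
          (#|ramification_group v i|%:R / #|ramification_group v 0|%:R) *
          (2 - logn q (count (fun P =>
             [forall s in ramification_group v i,
                (s P.1 == P.1) && (s P.2 == P.2)]) T).+1)%N%:R :> rat].

Definition conductor_exponent (M : weierstrass int) (l e : nat) : Prop :=
  if good_reduction M l then e = 0%N
  else if additive_reduction M l then exists2 d, wild_exponent M l d & e = d.+2
  else e = 1%N.

Definition conductor (M : weierstrass int) (N : nat) : Prop :=
  (0 < N)%N /\ forall l, prime l -> conductor_exponent M l (logn l N).

(* Functions on the upper half-plane are represented by functions on R[i];
   the values at z with Im z <= 0 are never used. *)

Definition cexp (R : realType) (z : R[i]) : R[i] :=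
  (expR (complex.Re z))%:C * (cos (complex.Im z) +i* sin (complex.Im z)).

Definition twopii (R : realType) : R[i] := 0 +i* (2 * pi).

(* f(z) = \sum_n u_n exp(2 pi i n z / h) *)
Definition fourier_expansion (R : realType) (f : R[i] -> R[i]) (h : nat)
    (u : nat -> R[i]) : Prop :=
  forall z : R[i], 0 < complex.Im z ->
    (series (fun n => u n * cexp (twopii R * n%:R * z / h%:R) : R[i]^o)
       : nat -> R[i]^o) @ \oo --> (f z : R[i]^o).

(* weight two action of the matrix (a b; c d) *)
Definition slash (R : realType) (f : R[i] -> R[i]) (a b c d : int) (z : R[i])
    : R[i] :=
  f ((a%:~R * z + b%:~R) / (c%:~R * z + d%:~R)) / (c%:~R * z + d%:~R) ^+ 2.

(* S_2(Gamma_0(N)).  Vanishing at the cusps: every f | g, with g in SL_2(Z), has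
   an expansion in positive powers of exp(2 pi i z / h) for some h > 0. *)
Definition cusp_form (R : realType) (N : nat) (f : R[i] -> R[i]) : Prop :=
  [/\ forall z : R[i], 0 < complex.Im z -> derivable (f : R[i]^o -> R[i]^o) z 1,
      forall a b c d : int, a * d - b * c = 1 -> (N%:Z %| c)%Z ->
        forall z : R[i], 0 < complex.Im z -> slash f a b c d z = f z
    & forall a b c d : int, a * d - b * c = 1 ->
        exists (h : nat) (u : nat -> R[i]),
          [/\ (0 < h)%N, u 0%N = 0 & fourier_expansion (slash f a b c d) h u]].

(* T_l, which is U_l when l divides N *)
Definition hecke (R : realType) (N l : nat) (f : R[i] -> R[i]) (z : R[i])
    : R[i] :=
  (if (l %| N)%N then 0 else l%:R * f (l%:R * z))
  + l%:R^-1 * \sum_(j < l) f ((z + j%:R) / l%:R).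

Definition hecke_eigenform (R : realType) (N : nat) (f : R[i] -> R[i]) : Prop :=
  forall l, prime l -> exists c : R[i], forall z : R[i],
    0 < complex.Im z -> hecke N l f z = c * f z.

(* f = f_E: L(f, s) = L(E, s) is expressed as equality of the coefficients of
   the two Dirichlet series. *)
Definition attached_form (R : realType) (M : weierstrass int) (N : nat)
    (f : R[i] -> R[i]) : Prop :=
  [/\ cusp_form N f, hecke_eigenform N f
    & exists u : nat -> R[i],
        [/\ fourier_expansion f 1 u, u 1%N = 1
          & forall n, (0 < n)%N -> u n = (L_coef M n)%:~R]].

(* P^1(Q), with None the point at infinity *)
Definition cusp : choiceType := option rat.

Definition integralC (R : realType) (D : set R) (g : R -> R[i]) : R[i] :=
  Rintegral (@lebesgue_measure R) D (fun t => complex.Re (g t))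
  +i* Rintegral (@lebesgue_measure R) D (fun t => complex.Im (g t)).

(* integral of f(z) dz from r to infinity along r + i t, t > 0 *)
Definition vertical_integral (R : realType) (f : R[i] -> R[i]) (r : rat) : R[i] :=
  integralC `]0, +oo[ (fun t : R => f (ratr r +i* t) * 'i%C).

(* integral of f(z) dz from max(r,s) to min(r,s) along the half-circle
   c + e exp(i t), 0 < t < pi *)
Definition halfcircle_integral (R : realType) (f : R[i] -> R[i]) (r s : rat)
    : R[i] :=
  let c : R := ratr ((r + s) / 2%:R) in
  let e : R := ratr (`|r - s| / 2%:R) in
  integralC `]0, pi[ (fun t : R =>
    f (c%:C + e%:C * (cos t +i* sin t)) * (e%:C * 'i%C * (cos t +i* sin t))).

(* integral of f(z) dz from s to r along the geodesic *)
Definition cusp_integral (R : realType) (f : R[i] -> R[i]) (s r : cusp) : R[i] :=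
  match s, r with
  | None, None => 0
  | Some s, None => vertical_integral f s
  | None, Some r => - vertical_integral f r
  | Some s, Some r => ratr (Num.sg (s - r)) * halfcircle_integral f r s
  end.

(* A homomorphism from Div^0(P^1(Q)) is represented by a function on all
   divisors whose values matter, and which is additive, in degree 0 only. *)
Definition modular_symbol (R : realType) (f : R[i] -> R[i])
    (phi : {freeg cusp} -> R[i]) : Prop :=
  (forall D D' : {freeg cusp}, deg D = 0 -> deg D' = 0 ->
     phi (D + D') = phi D + phi D') /\
  (forall r s : cusp,
     phi (<< r >> - << s >>) = twopii R * cusp_integral f s r).

Definition iota_divisor (D : {freeg cusp}) : {freeg cusp} :=
  fglift (fun r : cusp => << omap -%R r >>) D.

Definition plus_part (R : realType) (phi : {freeg cusp} -> R[i])
    (D : {freeg cusp}) : R[i] :=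
  (phi D + phi (iota_divisor D)) / 2%:R.

Definition ordp (p : nat) (x : rat) : \bar int :=
  if x == 0 then +oo%E
  else ((logn p `|numq x|%N)%:Z - (logn p `|denq x|%N)%:Z)%:E.

Definition padic_abs (p : nat) (x : rat) : rat :=
  if x == 0 then 0 else p%:R ^ (- fine (ordp p x)).

Definition cohomological_period (R : realType) (p : nat)
    (phi : {freeg cusp} -> R[i]) (Omega : R[i]) : Prop :=
  [/\ Omega != 0,
      forall D, deg D = 0 ->
        exists2 x : rat, plus_part phi D / Omega = ratr x & padic_abs p x <= 1
    & exists D, deg D = 0 /\
        exists2 x : rat, plus_part phi D / Omega = ratr x & padic_abs p x = 1].

(* R[G] is {ffun gT -> R}, with the convolution product gr_mul and not the
   pointwise product of finite functions. *)

Definition gr_of (R : nzRingType) (gT : finGroupType) (g : gT)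
    : {ffun gT -> R} := [ffun h => (h == g)%:R].

Definition gr_mul (R : nzRingType) (gT : finGroupType) (F G : {ffun gT -> R})
    : {ffun gT -> R} := [ffun g => \sum_(h : gT) F h * G (h^-1 * g)%g].

Definition gr_exp (R : nzRingType) (gT : finGroupType) (F : {ffun gT -> R})
    (i : nat) : {ffun gT -> R} := iter i (gr_mul F) (gr_of R 1%g).

Definition gr_scale (R : nzRingType) (gT : finGroupType) (c : R)
    (F : {ffun gT -> R}) : {ffun gT -> R} := [ffun g => c * F g].

(* The unique coefficients a_i in F = \sum_i a_i X^i, X = gamma - 1.  The period
   makes Mazur-Tate elements rational, so that Iwasawa invariants are only
   needed on Z_p[G] \cap Q[G] = Z_(p)[G]; there the a_i lie in Z_(p), and their
   p-adic valuation is ordp. *)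
Definition X_coef (gT : finGroupType) (gamma : gT) (F : {ffun gT -> rat})
    : {ffun 'I_#|gT| -> rat} :=
  xget 0 [set a : {ffun 'I_#|gT| -> rat} |
    F = \sum_(i < #|gT|)
          gr_scale (a i) (gr_exp (gr_of rat gamma - gr_of rat 1%g) i)].

Definition mu_invariant (p : nat) (gT : finGroupType) (gamma : gT)
    (F : {ffun gT -> rat}) : \bar int :=
  \big[Order.min/+oo%E]_(i < #|gT|) ordp p (X_coef gamma F i).

Definition lambda_invariant (p : nat) (gT : finGroupType) (gamma : gT)
    (F : {ffun gT -> rat}) : \bar int :=
  if F == 0 then +oo%E
  else \big[Order.min/+oo%E]_(i < #|gT| |
         ordp p (X_coef gamma F i) == mu_invariant p gamma F) (i%:Z)%:E.

Definition level (p n : nat) : nat := if p == 2%N then n.+2 else n.+1.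

(* L = Q(mu_q), and zeta generates mu_q *)
Definition cyclotomic_field (L : splittingFieldType rat) (q : nat) (zeta : L)
    : Prop :=
  q.-primitive_root zeta /\ <<1; zeta>>%VS = fullv.

(* the automorphism raising zeta to the power a, which exists if a is coprime
   to the order of zeta *)
Definition sigma (L : splittingFieldType rat) (zeta : L) (a : nat)
    : gal_of {:L} :=
  odflt 1%g [pick s : gal_of {:L} | s zeta == zeta ^+ a].

(* For p = 2, the subfield fixed by complex conjugation, which raises zeta to the
   power -1; for p odd, the only subfield of degree p^n. *)
Definition is_Kn (p n : nat) (L : splittingFieldType rat) (zeta : L)
    (K : {subfield L}) : Prop :=
  if p == 2%N
  then K = fixedField [set sigma zeta (2 ^ level 2 n).-1]%SET :> {vspace L}
  else \dim K = (p ^ n)%N.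

(* gal K s is the restriction of s to K. *)
Definition mazur_tate (R : realType) (p n : nat) (L : splittingFieldType rat)
    (zeta : L) (K : {subfield L}) (phi : {freeg cusp} -> R[i]) (Omega : R[i])
    : {ffun gal_of K -> R[i]} :=
  gr_scale Omega^-1 (\sum_(a < p ^ level p n | coprime a p)
    gr_scale
      (phi (<< (None : cusp) >> -
            << (Some ((a : nat)%:R / (p ^ level p n)%N%:R) : cusp) >>))
      (gr_of R[i] (gal K (sigma zeta a)))).

(* Main.v *)
Require Import Defs.
From HB Require Import structures.
From mathcomp Require Import all_boot all_order all_algebra all_fingroup.
From mathcomp Require Import all_solvable all_field.
From mathcomp Require Import complex freeg.
From mathcomp Require Import all_classical all_reals all_analysis.
From mathcomp Require Import measurable_realfun.
From mathcomp Require Import ring lra zify.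

Set Implicit Arguments.
Unset Strict Implicit.
Unset Printing Implicit Defensive.

Import Order.TTheory GRing.Theory Num.Theory.
Import numFieldNormedType.Exports.
Local Open Scope ring_scope.
Local Open Scope complex_scope.

(** Additive reduction at p makes the Euler factor of E at p trivial, so the
    Fourier coefficients a_n of f with p | n vanish; the constant term vanishes
    because f is cuspidal.  Averaging over translates keeps exactly these
    coefficients, hence
      f(z / p) + f((z + 1) / p) + ... + f((z + p - 1) / p) = 0
    on the upper half-plane ([sum_translates_eq0]).  Integrating along vertical
    lines, the symbols phi({oo} - {b / p}) add up to 0 when b runs through
    r, r + 1, ..., r + p - 1, for every rational r
    ([vertical_integral_sum_eq0]).  Exchanging sum and integral needs
    integrability of f on a vertical line: f decays exponentially at infinity,
    and at the other end of the line because f | g does, where g in SL_2(Z)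
    sends infinity to that cusp ([vertical_decay]).

    Write m = level p n and let h be the image in Gal(K_n / Q) of
    1 + p^(m-1).  The a's in one class modulo p^(m-1) are exactly the
    a (1 + p^(m-1))^k, so the relation above says that the coefficients of the
    Mazur-Tate element theta add up to 0 on every coset of the group generated by
    h ([mazur_tate_trace]).  Since Gal(K_n / Q) has order p^n and h has order p
    ([Kn_structure], resting on the irreducibility of the cyclotomic polynomial),
    theta dies in Q[Gal(K_(n-1) / Q)].

    With P = p^(n-1) and X = gamma - 1, this means that theta, as a polynomial in
    X, is divisible by (1 + X)^P - 1, a monic polynomial congruent to X^P modulo
    p.  Its first P coefficients therefore have valuation strictly larger than
    the minimal one, which is the bound on lambda ([lambda_ge_of_trace0]).

    Rationality and integrality of theta come from the plus part of phi: complex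
    conjugation is trivial on K_n, so a and -a contribute to the same
    coefficient, and phi can be replaced by its plus part
    ([mazur_tate_rational]). *)

(** * The p-adic valuation of rational numbers *)

Section Valuation.
Variables (p : nat) (p_prime : prime p).

Lemma ordp_frac (a b : int) : a != 0 -> b != 0 ->
  ordp p (a%:~R / b%:~R) = ((logn p `|a|)%:Z - (logn p `|b|)%:Z)%:E.
Proof.
move=> a0 b0; set x := _ / _.
have x0 : x != 0 by rewrite mulf_neq0 ?invr_eq0 ?intr_eq0.
rewrite /ordp (negbTE x0); congr (_%:E).
have E : (numq x * b = a * denq x)%R.
  apply: (@intr_inj rat); rewrite !intrM.
  have dn0 : (denq x)%:~R != 0 :> rat by rewrite intr_eq0 denq_eq0.
  have bn0 : b%:~R != 0 :> rat by rewrite intr_eq0.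
  have := divq_num_den x; rewrite {3}/x => /(congr1 (fun y => y * (denq x)%:~R * b%:~R)).
  by rewrite divfK // mulrAC divfK.
have n0 : numq x != 0 by rewrite numq_eq0.
have d0 : denq x != 0 by rewrite denq_eq0.
have /(congr1 (fun z : int => logn p `|z|)) := E.
rewrite !abszM !lognM ?absz_gt0 //; lia.
Qed.

Lemma ordpM x y : x != 0 -> y != 0 -> ordp p (x * y) = (ordp p x + ordp p y)%E.
Proof.
move=> x0 y0.
have n0 : numq x != 0 by rewrite numq_eq0.
have d0 : denq x != 0 by rewrite denq_eq0.
have n0' : numq y != 0 by rewrite numq_eq0.
have d0' : denq y != 0 by rewrite denq_eq0.
rewrite -{1}(divq_num_den x) -{1}(divq_num_den y) mulrACA -invfM -!intrM.
rewrite ordp_frac ?mulf_neq0 // !abszM !lognM ?absz_gt0 //.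
rewrite /ordp (negbTE x0) (negbTE y0) -EFinD; congr (_%:E); lia.
Qed.

Lemma ordp0 : ordp p 0 = +oo%E.
Proof. by rewrite /ordp eqxx. Qed.

Lemma ordp_eqy x : (ordp p x == +oo%E) = (x == 0).
Proof. by rewrite /ordp; case: (x == 0). Qed.

Lemma ordpD x y (c : int) : (c%:E <= ordp p x)%E -> (c%:E <= ordp p y)%E ->
  (c%:E <= ordp p (x + y))%E.
Proof.
have [->|x0] := eqVneq x 0; first by rewrite add0r.
have [->|y0] := eqVneq y 0; first by rewrite addr0.
have [->|xy0] := eqVneq (x + y) 0; first by rewrite ordp0 leey.
have n0 : numq x != 0 by rewrite numq_eq0.
have d0 : denq x != 0 by rewrite denq_eq0.
have n0' : numq y != 0 by rewrite numq_eq0.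
have d0' : denq y != 0 by rewrite denq_eq0.
rewrite {1 2}/ordp (negbTE x0) (negbTE y0) !lee_fin => cx cy.
have E : x + y = (numq x * denq y + numq y * denq x)%:~R / (denq x * denq y)%:~R.
  rewrite -{1}(divq_num_den x) -{1}(divq_num_den y) addf_div ?intr_eq0 //.
  by rewrite intrD !intrM.
have s0 : numq x * denq y + numq y * denq x != 0.
  by apply: contraNneq xy0 => s0; rewrite E s0 mul0r.
rewrite E ordp_frac ?mulf_neq0 // lee_fin abszM lognM ?absz_gt0 //.
set t := minn (logn p `|numq x| + logn p `|denq y|)
              (logn p `|numq y| + logn p `|denq x|).
suff : (t <= logn p `|(numq x * denq y + numq y * denq x)%R|)%N by rewrite /t; lia.
rewrite -pfactor_dvdn ?absz_gt0 //.
rewrite -(absz_nat (p ^ t)) -dvdzE rpredD // dvdzE /= abszM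
    pfactor_dvdn ?muln_gt0 ?absz_gt0 ?n0 ?n0' //;
  rewrite lognM ?absz_gt0 // /t ?geq_minl ?geq_minr //.
Qed.

Lemma ordpN x : ordp p (- x) = ordp p x.
Proof. by rewrite /ordp oppr_eq0 numqN denqN abszN. Qed.

Lemma ordp_ge_sum (I : Type) (r : seq I) (P : pred I) (F : I -> rat) (c : int) :
  (forall i, P i -> (c%:E <= ordp p (F i))%E) ->
  (c%:E <= ordp p (\sum_(i <- r | P i) F i))%E.
Proof.
move=> H; elim/big_ind: _ => //; first by rewrite ordp0 leey.
by move=> *; apply: ordpD.
Qed.

Lemma ordp_geM x y (c d : int) : (c%:E <= ordp p x)%E -> (d%:E <= ordp p y)%E ->
  ((c + d)%:E <= ordp p (x * y))%E.
Proof.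
have [->|x0] := eqVneq x 0; first by rewrite mul0r ordp0 !leey.
have [->|y0] := eqVneq y 0; first by rewrite mulr0 ordp0 !leey.
by move=> hx hy; rewrite ordpM // EFinD leeD.
Qed.

Lemma ordp_nat_ge1 (n : nat) : (p %| n)%N -> (1 <= ordp p n%:R)%E.
Proof.
move=> pn.
have [->|n0] := eqVneq n 0%N; first by rewrite ordp0 leey.
have := @ordp_frac n%:Z 1; rewrite divr1 => -> //.
rewrite lee_fin logn1 subr0 /= lez_nat -pfactor_dvdn ?expn1 //; lia.
Qed.

Lemma padic_abs_le1 x : padic_abs p x <= 1 -> (0 <= ordp p x)%E.
Proof.
have [->|x0] := eqVneq x 0; first by rewrite ordp0 leey.
rewrite /padic_abs /ordp (negbTE x0) /= -[X in _ <= X](expr0z p%:R).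
by rewrite ler_eXz2l ?ltr1n ?prime_gt1 // lee_fin oppr_le0.
Qed.

(** Division by a monic polynomial does not create denominators.  The form
    'X^P + s is monic as s has degree below P; comparing coefficients of degree
    P + j expresses B`_j through coefficients of B of larger index, so the bound
    descends from the top. *)
Lemma ordp_monic_quotient (P : nat) (s B : {poly rat}) (c : int) :
  (size s <= P)%N ->
  (forall i, (1 <= ordp p s`_i)%E) ->
  (forall i, (c%:E <= ordp p (('X^P + s) * B)`_i)%E) ->
  forall j, (c%:E <= ordp p B`_j)%E.
Proof.
move=> sP s1 aH.
suff H : forall k j, (size B <= j + k)%N -> (c%:E <= ordp p B`_j)%E.
  by move=> j; apply: (H (size B) j); rewrite leq_addl.
elim=> [|k IH] j; first by rewrite addn0 => /(nth_default 0)->; rewrite ordp0 leey.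
move=> jk.
have := aH (P + j)%N; rewrite mulrDl coefD coefXnM ltnNge leq_addr /= addKn.
set S := (s * B)`_ _ => h.
suff hS : (c%:E <= ordp p S)%E.
  by rewrite -[B`_j](addrK S); apply: ordpD => //; rewrite ordpN.
rewrite /S coefM; apply: ordp_ge_sum => i _.
case: (ltnP i P) => iP; last first.
  by rewrite (nth_default 0 (leq_trans sP iP)) mul0r ordp0 leey.
have -> : c = 0 + c by rewrite add0r.
apply: ordp_geM; first by apply: le_trans (s1 i); rewrite lee_fin.
by apply: IH; lia.
Qed.

(** Modulo p the factor 'X^P + s is 'X^P, so a multiple of it has no reduction in
    degrees below P: there only s contributes, and it brings a factor p. *)
Lemma ordp_low_coef (P : nat) (s B : {poly rat}) (c : int) :
  (size s <= P)%N ->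
  (forall i, (1 <= ordp p s`_i)%E) ->
  (forall i, (c%:E <= ordp p (('X^P + s) * B)`_i)%E) ->
  forall i, (i < P)%N -> ((c + 1)%:E <= ordp p (('X^P + s) * B)`_i)%E.
Proof.
move=> sP s1 aH i iP; have bH := ordp_monic_quotient sP s1 aH.
rewrite mulrDl coefD coefXnM iP add0r coefM addrC.
by apply: ordp_ge_sum => l _; apply: ordp_geM.
Qed.

End Valuation.

(** * The group ring of a cyclic group as a quotient of the polynomial ring *)

Section GroupRing.
Variables (gT : finGroupType) (gamma : gT).
Hypothesis gen : generator [set: gT]%SET gamma.
Local Notation N := #|gT|.

(** The image of a polynomial under the ring morphism Q[T] -> Q[G], T |-> gamma.
    It is surjective with kernel generated by T^#|G| - 1, so polynomials of degree
    below #|G| are faithful representatives ([gr_eval_coef]). *)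
Definition gr_eval (Q : {poly rat}) : {ffun gT -> rat} :=
  [ffun x => \sum_(k < size Q) Q`_k * (x == gamma ^+ k)%g%:R].

(** Any bound on the size may replace the size itself, which makes sums of
    polynomials of different sizes comparable. *)
Lemma gr_eval_wide m (Q : {poly rat}) x : (size Q <= m)%N ->
  gr_eval Q x = \sum_(k < m) Q`_k * (x == gamma ^+ k)%g%:R.
Proof.
move=> Qm; rewrite ffunE (big_ord_widen _ (fun k => Q`_k * (x == gamma ^+ k)%g%:R) Qm).
rewrite [RHS](bigID (fun k : 'I_m => (k < size Q)%N)) /= [X in _ + X]big1 ?addr0 //.
by move=> i; rewrite -leqNgt => /(nth_default 0)->; rewrite mul0r.
Qed.

Lemma gr_evalD Q1 Q2 : gr_eval (Q1 + Q2) = gr_eval Q1 + gr_eval Q2.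
Proof.
apply/ffunP => x; set m := maxn (size Q1) (size Q2).
rewrite [RHS]ffunE (@gr_eval_wide m) ?size_polyD // (@gr_eval_wide m Q1) ?leq_maxl //.
rewrite (@gr_eval_wide m Q2) ?leq_maxr // -big_split /=.
by apply: eq_bigr => i _; rewrite coefD mulrDl.
Qed.

Lemma gr_eval0 : gr_eval 0 = 0.
Proof. by apply/ffunP => x; rewrite !ffunE size_poly0 big_ord0. Qed.

Lemma gr_scaleE c (F : {ffun gT -> rat}) x : gr_scale c F x = c * F x.
Proof. by rewrite ffunE. Qed.

Lemma gr_evalZ c Q : gr_eval (c *: Q) = gr_scale c (gr_eval Q).
Proof.
apply/ffunP => x; rewrite [RHS]ffunE (@gr_eval_wide (size Q)) ?size_scale_leq //.
by rewrite ffunE mulr_sumr; apply: eq_bigr => i _; rewrite coefZ mulrA.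
Qed.

Lemma gr_eval1 : gr_eval 1 = gr_of rat 1%g.
Proof.
apply/ffunP => x; rewrite !ffunE size_polyC oner_eq0 big_ord1 coefC eqxx mul1r.
by rewrite expg0.
Qed.

Lemma gr_eval_mulX Q x : gr_eval ('X * Q) x = gr_eval Q (gamma^-1 * x)%g.
Proof.
rewrite (@gr_eval_wide (size Q).+1); last first.
  have [->|Q0] := eqVneq Q 0; first by rewrite mulr0 size_poly0.
  by rewrite mulrC size_mulX.
rewrite big_ord_recl coefXM eqxx mul0r add0r ffunE; apply: eq_bigr => i _.
rewrite coefXM /= /bump /= add1n /=; congr (_ * _%:R).
by congr (nat_of_bool _); rewrite expgS -[RHS](inj_eq (mulgI gamma)) mulKVg.
Qed.

Lemma gr_mul_of_sub (F : {ffun gT -> rat}) x :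
  gr_mul (gr_of rat gamma - gr_of rat 1%g) F x = F (gamma^-1 * x)%g - F x.
Proof.
rewrite ffunE.
under eq_bigr => h _ do rewrite !ffunE mulrBl.
rewrite sumrB; congr (_ - _).
  rewrite (bigD1 gamma) //= eqxx mul1r big1 ?addr0 // => h /negbTE->.
  by rewrite mul0r.
rewrite (bigD1 1%g) //= eqxx mul1r big1 ?addr0 ?invg1 ?mul1g // => h /negbTE->.
by rewrite mul0r.
Qed.

Lemma gr_exp_eval i :
  gr_exp (gr_of rat gamma - gr_of rat 1%g) i = gr_eval (('X - 1) ^+ i).
Proof.
elim: i => [|i IH]; first by rewrite expr0 gr_eval1.
rewrite /gr_exp iterS -/(gr_exp _ i) IH exprS mulrBl mul1r.
apply/ffunP => x; rewrite gr_mul_of_sub gr_evalD -(scaleN1r (_ ^+ i)) gr_evalZ.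
by rewrite [in RHS]ffunE gr_eval_mulX gr_scaleE mulN1r.
Qed.

Lemma order_gamma : #[gamma]%g = N.
Proof. by rewrite /order -(eqP gen) cardsT. Qed.

Lemma gr_eval_coef (Q : {poly rat}) k : (size Q <= N)%N -> (k < N)%N ->
  gr_eval Q (gamma ^+ k)%g = Q`_k.
Proof.
move=> QN kN; rewrite (@gr_eval_wide N) // (bigD1 (Ordinal kN)) //= eqxx mulr1.
rewrite big1 ?addr0 // => i ik.
rewrite (_ : (_ == _) = false) ?mulr0 //; apply: contraNF ik.
rewrite eq_expg_mod_order order_gamma !modn_small // => /eqP E.
by apply/eqP/val_inj.
Qed.

Lemma gamma_powP x : exists2 k, (k < N)%N & x = (gamma ^+ k)%g.
Proof.
have : x \in <[gamma]>%g by rewrite -(eqP gen) inE.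
by case/cyclePmin => k; rewrite order_gamma; exists k.
Qed.

Lemma size_comp_Xadd (Q : {poly rat}) c : size (Q \Po ('X + c%:P)) = size Q.
Proof. by rewrite size_comp_poly2 // size_XaddC. Qed.

Lemma sum_gr_exp (a : {ffun 'I_N -> rat}) :
  \sum_(i < N) gr_scale (a i) (gr_exp (gr_of rat gamma - gr_of rat 1%g) i) =
  gr_eval (\sum_(i < N) a i *: ('X - 1) ^+ i).
Proof.
rewrite (big_morph _ gr_evalD gr_eval0); apply: eq_bigr => i _.
by rewrite gr_evalZ gr_exp_eval.
Qed.

(** [X_coef] is an arbitrary choice in a set, with a junk value if that set is
    empty; this shows that it is not.  The expansion in powers of X = gamma - 1 is
    the Taylor expansion at 1 of the polynomial representing F. *)
Lemma X_coefP (F : {ffun gT -> rat}) :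
  F = gr_eval (\sum_(i < N) X_coef gamma F i *: ('X - 1) ^+ i).
Proof.
rewrite -sum_gr_exp /X_coef.
have [a aP] : exists a : {ffun 'I_N -> rat}, F = \sum_(i < N)
    gr_scale (a i) (gr_exp (gr_of rat gamma - gr_of rat 1%g) i).
  pose Q := \poly_(k < N) F (gamma ^+ k)%g.
  (* the coefficients of Q(T + 1) are those of Q in powers of T - 1 *)
  pose A := Q \Po ('X + 1%:P).
  exists [ffun i : 'I_N => A`_i]; rewrite sum_gr_exp.
  have -> : \sum_(i < N) [ffun i0 : 'I_N => A`_i0] i *: ('X - 1) ^+ i = Q.
    have -> : Q = A \Po ('X - 1%:P).
      by rewrite -comp_polyA comp_polyD comp_polyX comp_polyC subrK comp_polyXr.
    rewrite comp_polyE.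
    have sA : (size A <= N)%N by rewrite size_comp_Xadd size_poly.
    rewrite (big_ord_widen _ (fun i => A`_i *: ('X - 1%:P) ^+ i) sA).
    rewrite [LHS](bigID (fun k : 'I_N => (k < size A)%N)) /= [X in _ + X]big1.
      by rewrite addr0; apply: eq_bigr => i _; rewrite ffunE.
    move=> i; rewrite -leqNgt ffunE => /(nth_default 0)->; by rewrite scale0r.
  apply/ffunP => x; have [k kN ->] := gamma_powP x.
  by rewrite gr_eval_coef ?size_poly // coef_poly kN.
pose S := [set b : {ffun 'I_N -> rat} | F = \sum_(i < N)
    gr_scale (b i) (gr_exp (gr_of rat gamma - gr_of rat 1%g) i)]%classic.
exact: (@xgetPex _ 0 S (ex_intro S a aP)).
Qed.

End GroupRing.

(** * The lambda-invariant of an element of trace zero *)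

Lemma sum_ord_mul (V : nmodType) (p P : nat) (F : nat -> V) :
  \sum_(a < p * P) F a = \sum_(k < P) \sum_(j < p) F (k + j * P)%N.
Proof.
rewrite exchange_big -(big_mkord xpredT F) big_nat_mul big_mkord /=.
apply: eq_bigr => j _.
rewrite -{1}(add0n (j * P)%N) big_addn mulSn addnK big_mkord.
by apply: eq_bigr.
Qed.

(** Modulo 'X^P - 1 every 'X^(k + j * P) becomes 'X^k, and the hypothesis says that
    the resulting polynomial of degree below P is zero. *)
Lemma dvdp_Xn_sub1 (P : nat) (Q : {poly rat}) p : (size Q <= p * P)%N ->
  (forall k, (k < P)%N -> \sum_(j < p) Q`_(k + j * P) = 0) ->
  ('X^P - 1) %| Q.
Proof.
move=> sQ H.
have -> : Q = \sum_(k < P) \sum_(j < p) Q`_(k + j * P) *: 'X^(k + j * P).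
  rewrite {1}(_ : Q = \poly_(i < p * P) Q`_i); last first.
    apply/polyP => i; rewrite coef_poly; case: ltnP => // h.
    by rewrite nth_default // (leq_trans sQ).
  by rewrite poly_def (sum_ord_mul p P (fun i => Q`_i *: 'X^i)).
elim/big_ind: _ => [|u v|k _]; [exact: dvdp0 | exact: dvdp_add |].
have -> : \sum_(j < p) Q`_(k + j * P) *: 'X^(k + j * P) =
  \sum_(j < p) Q`_(k + j * P) *: ('X^k * ('X^P ^+ j - 1)) :> {poly rat}.
  apply/eqP; rewrite -subr_eq0 -sumrB; apply/eqP.
  transitivity (\sum_(j < p) Q`_(k + j * P) *: 'X^k : {poly rat}).
    apply: eq_bigr => j _; rewrite -scalerBr mulrBr mulr1 -exprM mulnC -exprD.
    by rewrite opprB addrC subrK.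
  by rewrite -scaler_suml H // scale0r.
elim/big_ind: _ => [|u v|j _]; [exact: dvdp0 | exact: dvdp_add |].
by rewrite -mul_polyC; do 2!apply: dvdp_mull; rewrite (subrX1 'X^P) dvdp_mulr.
Qed.

(** If p did not divide the coefficient, then i * 'C(p^n, i) = p^n * 'C(p^n - 1, i - 1)
    would force p^n to divide i. *)
Lemma dvdn_bin_prime_pow p n i : prime p -> (0 < i < p ^ n)%N ->
  (p %| 'C(p ^ n, i))%N.
Proof.
move=> pp /andP[]; case: i => // i _ iP; apply: contraLR isT => pC /=.
have co : coprime (p ^ n) 'C(p ^ n, i.+1) by rewrite coprimeXl // prime_coprime.
have /esym E := mul_bin_diag (p ^ n) i.
have : (p ^ n %| i.+1)%N.
  by rewrite -(Gauss_dvdl _ co) E dvdn_mulr.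
by move/dvdn_leq => /(_ isT); rewrite leqNgt iP.
Qed.

(** (1 + X)^(p^n) - 1 is the monic polynomial to which the valuation estimates
    apply. *)
Lemma Xadd1_prime_pow_expansion p n : prime p -> exists s : {poly rat},
  [/\ ('X + 1) ^+ (p ^ n) - 1 = 'X^(p ^ n) + s, (size s <= p ^ n)%N
    & forall i, (1 <= ordp p s`_i)%E].
Proof.
move=> pp; set P := (p ^ n)%N.
have P0 : (0 < P)%N by rewrite expn_gt0 prime_gt0.
pose s : {poly rat} := \poly_(i < P) (if i == 0%N then 0 else 'C(P, i)%:R).
exists s; split; first last.
- move=> i; rewrite coef_poly; case: ltnP => iP; last by rewrite ordp0 leey.
  case: eqP => [_|/eqP i0]; first by rewrite ordp0 leey.
  by apply: ordp_nat_ge1 => //; apply: dvdn_bin_prime_pow; rewrite ?lt0n ?i0.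
- exact: size_poly.
rewrite exprD1n big_ord_recr /= binn mulr1n -addrAC addrC; congr (_ + _).
rewrite /s poly_def {s}; case: (P) P0 => // k _.
rewrite !big_ord_recl /= bin0 mulr1n expr0 scale0r add0r addrAC subrr add0r.
by apply: eq_bigr => i _; rewrite scaler_nat.
Qed.

Lemma sum_cycle (gT : finGroupType) (V : nmodType) (h : gT) (F : gT -> V) :
  \sum_(x in <[h]>%g) F x = \sum_(k < #[h]%g) F (h ^+ k)%g.
Proof.
have -> : <[h]>%g = [set (h ^+ (k : 'I_#[h]%g))%g | k : 'I_#[h]%g]%SET.
  apply/setP => x; apply/idP/imsetP => [/cyclePmin[k kh ->]|[k _ ->]].
    by exists (Ordinal kh).
  exact: mem_cycle.
rewrite big_imset //= => i j _ _ /eqP.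
by rewrite eq_expg_mod_order !modn_small // => /eqP/val_inj.
Qed.

(** The elements of Q[G] whose coefficients have sum 0 on each coset of the
    subgroup of order p are the multiples of gamma^P - 1 = (1 + X)^P - 1, where
    P = p^n.  Modulo p this is X^P, so the minimal valuation of the coefficients
    cannot be attained before index P. *)
Lemma lambda_ge_of_trace0 (gT : finGroupType) (gamma h : gT) (p n : nat)
    (F : {ffun gT -> rat}) :
  prime p -> generator [set: gT]%SET gamma -> #|gT| = (p ^ n.+1)%N ->
  #[h]%g = p -> (forall g, \sum_(k < p) F (g * h ^+ k)%g = 0) ->
  ((p ^ n)%N%:Z%:E <= lambda_invariant p gamma F)%E.
Proof.
move=> pp gen cG oh trace.
set P := (p ^ n)%N; have NP : #|gT| = (p * P)%N by rewrite cG expnS.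
have og := order_gamma gen.
have P0 : (0 < P)%N by rewrite expn_gt0 prime_gt0.
have p0 : (0 < p)%N by rewrite prime_gt0.
(* h can be replaced by gamma^P: a cyclic group has one subgroup of order p *)
have trace' k : (k < P)%N -> \sum_(j < p) F (gamma ^+ (k + j * P))%g = 0.
  move=> _; have oP : #[gamma ^+ P]%g = p.
    by rewrite orderXdiv og NP ?dvdn_mull // mulnK.
  have eqc : <[h]>%g = <[gamma ^+ P]>%g.
    have cyc : cyclic [set: gT] by apply/cyclicP; exists gamma; apply/eqP.
    apply/eqP; rewrite (eq_subG_cyclic cyc (finset.subsetT _) (finset.subsetT _)).
    by rewrite -!orderE oh oP.
  have := sum_cycle h (fun x => F (gamma ^+ k * x)%g).
  rewrite oh eqc sum_cycle oP trace => E.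
  rewrite -[RHS]E.
  by apply: eq_bigr => j _; rewrite expgD mulnC expgM.
rewrite /lambda_invariant; case: eqP => [_|/eqP F0]; first by rewrite leey.
set a := X_coef gamma F.
(* A is F as a polynomial in X, and Q is F as a polynomial in gamma *)
pose A : {poly rat} := \poly_(i < #|gT|) oapp a 0 (insub i).
have Aa (i : 'I_#|gT|) : A`_i = a i by rewrite coef_poly ltn_ord valK.
have sA : (size A <= #|gT|)%N by exact: size_poly.
pose Q := A \Po ('X - 1%:P).
have sQ : (size Q <= #|gT|)%N by rewrite /Q -polyCN size_comp_Xadd.
have FA : F = gr_eval gamma Q.
  rewrite (X_coefP gen F); congr (gr_eval gamma _).
  rewrite /Q comp_polyE (big_ord_widen _ (fun i => A`_i *: ('X - 1%:P) ^+ i) sA).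
  rewrite [RHS]big_mkcond; apply: eq_bigr => i _ /=; rewrite Aa.
  by case: ltnP => // /(nth_default 0); rewrite Aa => ->; rewrite scale0r.
have [B AB] : exists B, A = (('X + 1) ^+ P - 1) * B.
  have : ('X^P - 1) %| Q.
    apply: (@dvdp_Xn_sub1 P Q p) => [|k kP]; first by rewrite -NP.
    rewrite -[RHS](trace' k kP); apply: eq_bigr => j _.
    rewrite FA gr_eval_coef // NP; have := ltn_ord j; nia.
  case/dvdpP => B QB; exists (B \Po ('X + 1%:P)).
  have -> : A = Q \Po ('X + 1%:P).
    by rewrite -comp_polyA comp_polyB comp_polyX comp_polyC addrK comp_polyXr.
  by rewrite QB comp_polyM mulrC comp_polyB rmorphXn /= comp_polyX comp_polyC.
have [s [ws sP s1]] := Xadd1_prime_pow_expansion n pp.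
rewrite ws in AB.
elim/big_ind: _ => [|x y hx hy|i /eqP imu]; first by rewrite leey.
  by rewrite le_min hx.
rewrite lee_fin lez_nat leqNgt; apply/negP => iP.
have amu j : (ordp p (a i) <= ordp p (a j))%E.
  by rewrite imu /mu_invariant; apply: bigmin_le_cond.
have [ai0|ai0] := eqVneq (a i) 0.
  case/eqP: F0; rewrite FA /Q.
  suff -> : A = 0 by rewrite comp_poly0 gr_eval0.
  apply/polyP => j; rewrite coef0 coef_poly; case: ltnP => // jN.
  rewrite insubT /=; apply/eqP; rewrite -(ordp_eqy p) -leye_eq.
  by apply: le_trans (amu _); rewrite ai0 ordp0.
have [c ac] : exists c : int, ordp p (a i) = c%:E.
  by rewrite /ordp (negbTE ai0); eexists.
have : ((c + 1)%:E <= ordp p A`_i)%E.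
  rewrite AB; apply: (ordp_low_coef pp sP s1) => // j; rewrite -AB coef_poly.
  case: ltnP => jN; last by rewrite ordp0 leey.
  by rewrite insubT /= -ac.
by rewrite Aa ac lee_fin; lia.
Qed.

(** * Galois theory of a cyclotomic field *)

Section CyclotomicGalois.
Variables (L : splittingFieldType rat) (q : nat) (zeta : L).
Hypothesis prim : q.-primitive_root zeta.
Hypothesis full : (<<1; zeta>> = fullv)%VS.
Local Notation Phi := (map_poly intr (Cyclotomic q) : {poly rat}).

Lemma size_Phi : size Phi = (totient q).+1.
Proof.
rewrite size_map_poly_id0 ?size_Cyclotomic //.
by rewrite (monicP (Cyclotomic_monic q)) oner_eq0.
Qed.

(** z is a root of 'X^q - 1, the product of the cyclotomic polynomials of index
    d | q; being a root of the d-th one forces z^d = 1, hence d = q. *)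
Lemma root_Cyclotomic_prim (z : L) : q.-primitive_root z ->
  root (map_poly (in_alg L) Phi) z.
Proof.
move=> pz; have q0 := prim_order_gt0 pz.
have intL (x : {poly int}) : map_poly (in_alg L) (map_poly intr x) = map_poly intr x.
  by rewrite -map_poly_comp; apply: eq_map_poly => b; apply: (rmorph_int (in_alg L)).
have : root (map_poly intr ('X^q - 1 : {poly int})) z.
  by rewrite rmorphB rmorph1 /= map_polyXn rootE !hornerE (prim_expr_order pz) subrr.
rewrite -prod_Cyclotomic // rmorph_prod /= => rz.
have [d dq rd] : exists2 d, (d %| q)%N & root (map_poly intr (Cyclotomic d)) z.
  move: rz; rewrite rootE horner_prod prodf_seq_eq0 => /hasP[d dd /= zd].
  by exists d => //; rewrite dvdn_divisors.
rewrite intL; suff <- : d = q by [].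
apply/eqP; rewrite eqn_dvd dq /= (prim_order_dvd pz).
have d0 : (0 < d)%N by exact: dvdn_gt0 dq.
have : root (map_poly intr ('X^d - 1 : {poly int})) z.
  rewrite -prod_Cyclotomic // rmorph_prod /= rootE horner_prod prodf_seq_eq0.
  by apply/hasP; exists d => //; rewrite -dvdn_divisors.
by rewrite rmorphB rmorph1 /= map_polyXn rootE !hornerE subr_eq0.
Qed.

(** The cyclotomic polynomial is a prime element of Q[X], because it is the minimal
    polynomial of a primitive root of unity among the algebraic complex numbers. *)
Lemma Phi_irr (a b : {poly rat}) : Phi = a * b -> (Phi %| a) || (Phi %| b).
Proof.
move=> E; have q0 := prim_order_gt0 prim.
have [z pz] := C_prim_root_exists q0.
have [f [mf _] fP] := minCpolyP z.
have ff : map_poly (ratr : rat -> algC) f = map_poly ratr Phi.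
  rewrite -mf (minCpoly_cyclotomic pz) -(Cintr_Cyclotomic pz) -map_poly_comp.
  by apply: eq_map_poly => x /=; rewrite rmorph_int.
have <- : f = Phi := map_inj_poly (fmorph_inj _) (rmorph0 _) ff.
rewrite -!fP -rootM -rmorphM -E /= -ff -mf.
exact: root_minCpoly.
Qed.

Lemma minPoly_zeta : minPoly 1 zeta = map_poly (in_alg L) Phi.
Proof.
have /polyOver1P[f fE] := minPolyOver 1 zeta.
have rf : root (map_poly (in_alg L) f) zeta by rewrite -fE root_minPoly.
have fPhi : f %| Phi.
  rewrite -(dvdp_map (in_alg L)) -fE minPoly_dvdp ?root_Cyclotomic_prim //.
  by apply/polyOver1P; exists Phi.
have sf : (1 < size f)%N.
  rewrite -(size_map_poly (in_alg L)) -fE size_minPoly ltnS.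
  by rewrite /adjoin_degree.
have Phif : Phi %| f.
  have /dvdpP[r rE] := fPhi.
  have /orP[|//] := Phi_irr rE => Phir.
  have P0 : Phi != 0 by rewrite -size_poly_eq0 size_Phi.
  have r0 : r != 0 by apply: contraNneq P0 => r0; rewrite rE r0 mul0r.
  have f0 : f != 0 by apply: contraNneq P0 => f0; rewrite rE f0 mulr0.
  have := dvdp_leq r0 Phir; rewrite rE size_mul //; move: (size r) (size f) sf; lia.
rewrite fE; apply/eqP; rewrite -eqp_monic.
- by rewrite eqp_map /eqp fPhi.
- by rewrite -fE monic_minPoly.
- rewrite map_monic; apply: monic_map; exact: Cyclotomic_monic.
Qed.

Lemma dim_cyclotomic : \dim {:L} = totient q.
Proof.
rewrite -full (dim_Fadjoin 1%AS zeta) dimv1 muln1.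
by apply: succn_inj; rewrite -size_minPoly minPoly_zeta size_map_poly size_Phi.
Qed.

(** zeta^a is a conjugate of zeta, as both are roots of the minimal polynomial, so
    the automorphism sought by [sigma] exists. *)
Lemma sigmaE a : coprime a q -> sigma zeta a zeta = zeta ^+ a.
Proof.
move=> co; rewrite /sigma; case: pickP => [s /eqP //|none].
have pza : q.-primitive_root (zeta ^+ a) by rewrite prim_root_exp_coprime.
have ra : root (minPoly 1 zeta) (zeta ^+ a).
  by rewrite minPoly_zeta root_Cyclotomic_prim.
have [x _ /eqP] := normalField_root_minPoly (sub1v {:L}) (normalFieldf 1%AS)
   (memvf zeta) ra.
by rewrite none.
Qed.

Lemma gal_over_rat (K : {subfield L}) : 'Gal(K / 1)%g = [set: gal_of K]%SET.
Proof.
by apply/setP => x; rewrite inE gal_kHom ?sub1v // k1AHom.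
Qed.

Lemma gal_zeta_eq (x y : gal_of {:L}) : x zeta = y zeta -> x = y.
Proof.
move=> E; apply/eqP/gal_eqP => a _.
have : a \in <<1; zeta>>%VS by rewrite full memvf.
case/Fadjoin1_polyP => f ->.
rewrite -!horner_map -!map_poly_comp /= E; congr (_.[_]).
by apply: eq_map_poly => c /=; rewrite !linearZ /= !rmorph1.
Qed.

Lemma gal_zetaX (x : gal_of {:L}) : exists2 a, coprime a q & x zeta = zeta ^+ a.
Proof.
have px : q.-primitive_root (x zeta) by rewrite fmorph_primitive_root.
have [a xa] := prim_rootP prim (prim_expr_order px); exists a => //.
by rewrite -(prim_root_exp_coprime a prim) -xa.
Qed.

Lemma galLM (x y : gal_of {:L}) a b :
  x zeta = zeta ^+ a -> y zeta = zeta ^+ b -> (x * y)%g zeta = zeta ^+ (a * b).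
Proof. by move=> xa yb; rewrite galM ?memvf // xa rmorphXn /= yb -exprM mulnC. Qed.

Lemma gal_cyclotomic_abelian : abelian 'Gal({:L} / 1)%g.
Proof.
apply/centsP => x _ y _; apply: gal_zeta_eq.
have [a _ xa] := gal_zetaX x; have [b _ yb] := gal_zetaX y.
by rewrite (galLM xa yb) (galLM yb xa) mulnC.
Qed.

Lemma galois_cyclotomic : galois 1 {:L}.
Proof.
rewrite /galois sub1v normalFieldf andbT /=.
apply/separableP => x _; apply/pcharf0_separable => r.
by rewrite (pchar_lalg L) pchar_num.
Qed.

(** The whole Galois group being abelian, all its subgroups are normal. *)
Lemma galois_subfield (K : {subfield L}) : galois 1 K.
Proof.
have gKL : galois K {:L} by apply: galoisS galois_cyclotomic; rewrite sub1v subvf.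
have nor : normal 'Gal({:L} / K)%g 'Gal({:L} / 1)%g.
  by rewrite -sub_abelian_normal ?gal_cyclotomic_abelian ?galS ?sub1v.
have := normal_fixedField_galois galois_cyclotomic nor.
by have /galois_fixedField-> := gKL.
Qed.

(** [gal K] is defined for every endomorphism of L, but is restriction only for
    those that stabilise K; here all automorphisms do. *)
Lemma gal_restrictE (K : {subfield L}) (x : gal_of {:L}) : {in K, gal K x =1 x}.
Proof.
have /and3P[_ _ nK] := galois_subfield K.
have s : (1 <= K <= {:L})%VS by rewrite sub1v subvf.
by apply: (normalField_cast_eq s nK); rewrite gal_over_rat inE.
Qed.

Lemma gal_restrictM (K : {subfield L}) (x y : gal_of {:L}) :
  gal K (x * y)%g = (gal K x * gal K y)%g.
Proof.
have /and3P[_ _ nK] := galois_subfield K.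
have s : (1 <= K <= {:L})%VS by rewrite sub1v subvf.
by apply: (normalField_castM s nK); rewrite gal_over_rat inE.
Qed.

Lemma gal_restrict1 (K : {subfield L}) (x : gal_of {:L}) :
  (gal K x == 1%g) = (x \in 'Gal({:L} / K)%g).
Proof.
rewrite gal_kHom ?subvf //; apply/gal_eqP/kAHomP => H a Ka.
  by rewrite -(gal_restrictE x Ka) H // gal_id.
by rewrite gal_restrictE // H // gal_id.
Qed.

Lemma card_gal (K : {subfield L}) : #|{: gal_of K}| = \dim K.
Proof. by rewrite -cardsT -gal_over_rat -(galois_dim (galois_subfield K)) dimv1 divn1. Qed.

Lemma card_gal_times_dim (K : {subfield L}) :
  (#|'Gal({:L} / K)%g| * \dim K = totient q)%N.
Proof.
have gKL : galois K {:L} by apply: galoisS galois_cyclotomic; rewrite sub1v subvf.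
rewrite -(galois_dim gKL) divnK ?dim_cyclotomic // -dim_cyclotomic.
by rewrite field_dimS ?subvf.
Qed.

Lemma sigmaM a b : coprime a q -> coprime b q ->
  sigma zeta (a * b) = (sigma zeta a * sigma zeta b)%g.
Proof.
move=> ca cb; apply: gal_zeta_eq.
by rewrite sigmaE ?coprimeMl ?ca // (galLM (sigmaE ca) (sigmaE cb)).
Qed.

Lemma sigma_mod a b : a = b %[mod q] -> sigma zeta a = sigma zeta b.
Proof.
by move=> ab; rewrite /sigma -(prim_expr_mod prim a) ab (prim_expr_mod prim).
Qed.

Lemma sigma_eq1 a : coprime a q -> (sigma zeta a == 1%g) = (a == 1 %[mod q]).
Proof.
move=> co; rewrite -(eq_prim_root_expr prim); apply/eqP/eqP => [E|E].
  by rewrite -sigmaE // E gal_id expr1.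
by apply: gal_zeta_eq; rewrite sigmaE // E gal_id expr1.
Qed.

End CyclotomicGalois.

(** * The Galois group of the n-th layer *)

(** The square of p^(m-1) vanishes modulo p^m, so the units congruent to 1 modulo
    p^(m-1) behave additively. *)
Lemma pow_1Dp_mod p m k : (1 < m)%N ->
  (1 + p ^ m.-1) ^ k = 1 + k * p ^ m.-1 %[mod p ^ m].
Proof.
move=> m1; elim: k => [|k IH]; first by rewrite expn0.
rewrite expnS -modnMmr IH modnMmr.
have -> : ((1 + p ^ m.-1) * (1 + k * p ^ m.-1) =
  k * p ^ (m.-2) * p ^ m + (1 + k.+1 * p ^ m.-1))%N.
  have e : (p ^ m.-1 * p ^ m.-1 = p ^ m.-2 * p ^ m)%N.
    by rewrite -!expnD; congr (_ ^ _)%N; lia.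
  by rewrite -mulnA -e; lia.
by rewrite modnMDl.
Qed.

(** In this section [rho] is the map a |-> pi_n(sigma_a) and [u] generates the
    kernel of the reduction of units modulo p^m to units modulo p^(m-1). *)

Section Kn.
Variables (p n : nat) (L : splittingFieldType rat) (zeta : L) (K : {subfield L}).
Hypotheses (p_prime : prime p) (n_gt0 : (0 < n)%N).
Hypothesis cycl : cyclotomic_field (p ^ level p n) zeta.
Hypothesis KnK : is_Kn p n zeta K.
Local Notation m := (level p n).
Local Notation rho a := (gal K (sigma zeta a)).
Local Notation u := (1 + p ^ m.-1)%N.

Let prim := cycl.1.
Let full := cycl.2.

Lemma level_gt1 : (1 < m)%N.
Proof. by rewrite /level; case: ifP => _; rewrite !ltnS. Qed.

Lemma coprime_level a : coprime a (p ^ m) = coprime a p.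
Proof. by rewrite coprime_pexpr // ltnW // level_gt1. Qed.

Lemma rho_mul a b : coprime a p -> coprime b p -> rho (a * b) = (rho a * rho b)%g.
Proof.
rewrite -!coprime_level => ca cb.
by rewrite (sigmaM prim full ca cb) (gal_restrictM prim full).
Qed.

Lemma rho_mod a b : a = b %[mod p ^ m] -> rho a = rho b.
Proof. by move=> ab; rewrite (sigma_mod prim ab). Qed.

Lemma rho1 : rho 1 = 1%g.
Proof.
apply/eqP; rewrite (gal_restrict1 prim full).
suff -> : sigma zeta 1 = 1%g by apply: group1.
by apply/eqP; rewrite (sigma_eq1 prim full) // coprime1n.
Qed.

Lemma rho_exp a k : coprime a p -> rho (a ^ k) = (rho a ^+ k)%g.
Proof.
move=> co; elim: k => [|k IH]; first by rewrite expn0 rho1 expg0.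
by rewrite expnS rho_mul ?coprimeXl // IH expgS.
Qed.

Lemma coprime_unit : coprime u p.
Proof.
have m1 := level_gt1.
rewrite coprime_sym prime_coprime // dvdn_addl ?dvdn_exp //; last by lia.
by rewrite dvdn1; have := prime_gt1 p_prime; lia.
Qed.

(** With b an inverse of a modulo p, a + j p^(m-1) is congruent to
    a (1 + b j p^(m-1)), which is a u^(b j). *)
Lemma rho_translate a j : coprime a p ->
  exists k, rho (a + j * p ^ m.-1) = (rho a * rho u ^+ k)%g.
Proof.
move=> ca; have m1 := level_gt1.
have p0 := prime_gt0 p_prime.
have [b bE] : exists b, (a * b = 1 %[mod p])%N.
  case: (egcdnP p (m := a)).
    by rewrite lt0n; apply: contraTneq ca => ->; rewrite /coprime gcd0n;
      have := prime_gt1 p_prime; lia.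
  move=> b c E _; exists b; rewrite mulnC E (eqP ca) addnC.
  by rewrite -modnDmr modnMl addn0.
exists (b * j)%N; rewrite -rho_exp ?coprime_unit // -rho_mul ?coprimeXl ?coprime_unit //.
apply: rho_mod; apply/esym; rewrite -modnMmr pow_1Dp_mod // modnMmr.
rewrite mulnDr muln1; apply/eqP; rewrite eqn_modDl; apply/eqP.
have pm : (p ^ m = p * p ^ m.-1)%N by rewrite -expnS; congr (_ ^ _)%N; lia.
rewrite mulnA [(a * _)%N]mulnA pm -!muln_modl; congr (_ * _)%N.
by rewrite -modnMml bE modnMml mul1n.
Qed.

Lemma unit_neq1 : (u == 1 %[mod p ^ m]) = false.
Proof.
have m1 := level_gt1.
have pm : (p ^ m = p * p ^ m.-1)%N by rewrite -expnS; congr (_ ^ _)%N; lia.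
apply/negP; rewrite eqn_mod_dvd ?leq_addr // addKn pm => /dvdn_leq.
rewrite expn_gt0 prime_gt0 // => /(_ isT).
have := prime_gt1 p_prime; have : (0 < p ^ m.-1)%N by rewrite expn_gt0 prime_gt0.
nia.
Qed.

Lemma order_sigma_unit : #[sigma zeta u]%g = p.
Proof.
have m1 := level_gt1; have cu := coprime_unit; have cu' := cu.
rewrite -coprime_level in cu'.
apply: nt_prime_order => //; last first.
  by rewrite (sigma_eq1 prim full) // unit_neq1.
have X k : (sigma zeta u ^+ k)%g = sigma zeta (u ^ k).
  elim: k => [|k IH].
    by rewrite expg0; apply/esym/eqP; rewrite (sigma_eq1 prim full) // coprime1n.
  by rewrite expgS IH expnS (sigmaM prim full) ?coprimeXl.
apply/eqP; rewrite X (sigma_eq1 prim full) ?coprimeXl //.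
rewrite pow_1Dp_mod // -expnS prednK; last by lia.
by rewrite addnC modnDl.
Qed.

Lemma sigma_opp1_sq : (sigma zeta (p ^ m).-1 ^+ 2)%g = 1%g.
Proof.
have q1 : (1 < p ^ m)%N.
  by rewrite -(expn0 p) ltn_exp2l ?prime_gt1 // ltnW // level_gt1.
have c1 : coprime (p ^ m).-1 (p ^ m) by rewrite coprimePn // ltnW.
apply/eqP; rewrite expgS expg1 -(sigmaM prim full) // (sigma_eq1 prim full) ?coprimeMl ?c1 //.
have -> : ((p ^ m).-1 * (p ^ m).-1 = (p ^ m).-2 * p ^ m + 1)%N.
  move: (p ^ m)%N q1 => q q1; nia.
by rewrite modnMDl.
Qed.

(** For p odd, Gal(L / K) has order p - 1 by counting degrees, so it cannot contain
    the element sigma_u of order p; and complex conjugation, of order dividing 2,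
    is trivial in a group of odd order p^n.  For p = 2, Gal(L / K) consists of 1
    and complex conjugation, and u is congruent to neither 1 nor -1 modulo
    2^(n+2). *)
Lemma Kn_structure : [/\ #|{: gal_of K}| = (p ^ n)%N, #[rho u]%g = p
  & rho (p ^ m).-1 = 1%g].
Proof.
have m1 := level_gt1; have p1 := prime_gt1 p_prime.
have cK := card_gal_times_dim prim full K.
have cu : coprime u (p ^ m) by rewrite coprime_level coprime_unit.
have q1 : (1 < p ^ m)%N by rewrite -(expn0 p) ltn_exp2l // ltnW.
have c1 : coprime (p ^ m).-1 (p ^ m) by rewrite coprimePn // ltnW.
have hu : (rho u ^+ p)%g = 1%g.
  rewrite -rho_exp ?coprime_unit // -rho1; apply: rho_mod.
  by rewrite pow_1Dp_mod // -expnS prednK 1?addnC ?modnDl //; lia.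
rewrite (card_gal prim full).
rewrite totient_pfactor // in cK; last by lia.
move: KnK; rewrite /is_Kn; case: eqP => [p2 KE|p2 dK].
  have m2 : m = n.+2 by rewrite /level p2.
  (* c is complex conjugation *)
  set c := sigma zeta (2 ^ level 2 n).-1 in KE.
  have cE : c = sigma zeta (p ^ m).-1 by rewrite /c p2.
  have nc : c != 1%g.
    rewrite cE (sigma_eq1 prim full) // eqn_mod_dvd; last by lia.
    apply/negP => /dvdn_leq; rewrite m2 p2 !expnS; have : (0 < 2 ^ n)%N by rewrite expn_gt0.
    lia.
  have oc : #[c]%g = 2%N by apply: nt_prime_order; rewrite // cE sigma_opp1_sq.
  have galK2 : 'Gal({:L} / K)%g = <[c]>%g by rewrite KE gal_generated.
  have dK : \dim K = (2 ^ n)%N.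
    move: cK; rewrite galK2 -orderE oc m2 p2 /= expnS; lia.
  have cK1 : rho (p ^ m).-1 = 1%g.
    by apply/eqP; rewrite (gal_restrict1 prim full) galK2 -cE cycle_id.
  split=> //; first by rewrite p2.
  apply: nt_prime_order => //; rewrite (gal_restrict1 prim full) galK2.
  rewrite cycle2g // !inE negb_or (sigma_eq1 prim full) // unit_neq1 /=.
  apply/negP => /eqP E.
  have := congr1 (fun s : gal_of {:L} => s zeta) E.
  rewrite cE !(sigmaE prim) // => /eqP.
  rewrite (eq_prim_root_expr prim) m2 p2 /=.
  have -> : (2 ^ n.+2 = 4 * 2 ^ n)%N by rewrite !expnS mulnA.
  have : (2 <= 2 ^ n)%N by rewrite -{1}(expn1 2) leq_exp2l.
  rewrite expnS; move: (2 ^ n)%N => X X2.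
  by rewrite !modn_small; lia.
have mE : m = n.+1 by rewrite /level; case: eqP.
have pn0 : (0 < p ^ n)%N by rewrite expn_gt0 prime_gt0.
have cG : #|'Gal({:L} / K)%g| = p.-1.
  by apply/eqP; rewrite -(eqn_pmul2r pn0) -{1}dK cK mE.
split=> //.
  apply: nt_prime_order => //; rewrite (gal_restrict1 prim full).
  apply/negP => /order_dvdG; rewrite order_sigma_unit cG => /dvdn_leq; lia.
have : (rho (p ^ m).-1 ^+ 2)%g = 1%g.
  have := sigma_opp1_sq; rewrite expgS expg1 => E2.
  rewrite expgS expg1 -(gal_restrictM prim full) E2.
  apply/eqP; rewrite (gal_restrict1 prim full) group1 //.
move/eqP; rewrite -order_dvdn => d2.
have : (#[rho (p ^ m).-1]%g %| p ^ n)%N.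
  by rewrite -dK -(card_gal prim full) -cardsT; apply: order_dvdG; rewrite inE.
move=> dn; apply/eqP; rewrite -order_eq1 -dvdn1.
have co : coprime 2 (p ^ n).
  by rewrite coprimeXr // prime_coprime // dvdn_prime2 //; apply/eqP => /esym.
by rewrite -(eqP co) dvdn_gcd d2 dn.
Qed.

End Kn.

(** * Fourier expansions *)

Section ComplexAnalysis.
Import ComplexField.Normc.
Variable R : realType.
Implicit Types (z w : R[i]) (f : R[i] -> R[i]) (u : nat -> R[i]).
Local Notation normc := (@normc R).

Lemma natr_complex (n : nat) : n%:R = (n%:R : R)%:C :> R[i].
Proof. by rewrite rmorph_nat. Qed.

Lemma normcR (x : R) : normc x%:C = `|x|.
Proof. by rewrite /= expr0n addr0 sqrtr_sqr. Qed.

Lemma normc_ge0 z : 0 <= normc z.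
Proof. by case: z => a b; rewrite /= sqrtr_ge0. Qed.

Lemma normc_ge_absRe z : `|complex.Re z| <= normc z.
Proof. by rewrite -lecR; apply: normc_ge_Re. Qed.

Lemma normc_sum (I : Type) (r : seq I) (P : pred I) (F : I -> R[i]) :
  normc (\sum_(i <- r | P i) F i) <= \sum_(i <- r | P i) normc (F i).
Proof.
elim/big_ind2: _ => //; first by rewrite normc0.
by move=> x a y b xa yb; apply: le_trans (le_normcD (R := R) _ _) _; apply: lerD.
Qed.

Lemma Re_sum (I : Type) (r : seq I) (P : pred I) (F : I -> R[i]) :
  complex.Re (\sum_(i <- r | P i) F i) = \sum_(i <- r | P i) complex.Re (F i).
Proof. by elim/big_ind2: _ => // _ [a b] _ [c d] <- <-. Qed.

Lemma Im_sum (I : Type) (r : seq I) (P : pred I) (F : I -> R[i]) :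
  complex.Im (\sum_(i <- r | P i) F i) = \sum_(i <- r | P i) complex.Im (F i).
Proof. by elim/big_ind2: _ => // _ [a b] _ [c d] <- <-. Qed.

Lemma cexpD z w : cexp (z + w) = cexp z * cexp w.
Proof.
case: z => a b; case: w => c d; rewrite /cexp /= expRD cosD sinD.
by simpc; congr (_ +i* _); ring.
Qed.

Lemma cexp0 : cexp (0 : R[i]) = 1.
Proof. by rewrite /cexp /= expR0 cos0 sin0 mul1r. Qed.

Lemma cexpX z n : cexp (n%:R * z) = cexp z ^+ n.
Proof.
elim: n => [|n IH]; first by rewrite mul0r cexp0 expr0.
by rewrite exprS -natr1 mulrDl mul1r addrC cexpD IH.
Qed.

Lemma normc_cexp z : normc (cexp z) = expR (complex.Re z).
Proof.
rewrite /cexp normcM normcR ger0_norm ?expR_ge0 //=.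
by rewrite cos2Dsin2 sqrtr1 mulr1.
Qed.

Lemma cexp_twopii : cexp (twopii R) = 1.
Proof. by rewrite /cexp /= expR0 mulr_natl cos2pi sin2pi mul1r. Qed.

Lemma fourier_argE (h n : nat) z :
  twopii R * n%:R * z / h%:R =
  (2 * pi * n%:R / h%:R)%:C * (- complex.Im z +i* complex.Re z).
Proof.
case: z => x y; rewrite !natr_complex -fmorphV /twopii /=; simpc.
by congr (_ +i* _); ring.
Qed.

Lemma fourier_expansion_dist f h u z (e : R) :
  fourier_expansion f h u -> 0 < complex.Im z -> 0 < e ->
  exists N0 : nat, forall N, (N0 <= N)%N ->
    normc (f z - \sum_(n < N) u n * cexp (twopii R * n%:R * z / h%:R)) < e.
Proof.
move=> fe zi e0.
have e0C : 0 < (e%:C : R[i]) by rewrite ltcR.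
have /cvgrPdist_lt /(_ e%:C e0C) [N0 _ H] := fe z zi.
exists N0 => N NN; have := H N NN; rewrite /series /= big_mkord.
by rewrite -ltcR.
Qed.

Lemma normc_fourier_term (h n : nat) z :
  normc (cexp (twopii R * n%:R * z / h%:R)) =
  expR (- (2 * pi / h%:R * complex.Im z)) ^+ n.
Proof.
rewrite normc_cexp fourier_argE -expRM_natl; congr expR.
by simpc => /=; ring.
Qed.

(** The terms of a convergent series are bounded.  Applied at height y, this bounds
    the coefficients by a geometric progression. *)
Lemma fourier_coef_bound f h u (y : R) :
  fourier_expansion f h u -> 0 < y ->
  exists2 B : R, 0 <= B &
    forall n, normc (u n) * expR (- (2 * pi / h%:R * y)) ^+ n <= B.
Proof.
move=> fe y0; pose z : R[i] := 0 +i* y.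
pose t n := u n * cexp (twopii R * n%:R * z / h%:R).
have tE n : normc (t n) = normc (u n) * expR (- (2 * pi / h%:R * y)) ^+ n.
  by rewrite /t normcM normc_fourier_term.
have [N0 H] := fourier_expansion_dist fe (y0 : 0 < complex.Im z) ltr01.
(* beyond N0 a term is the difference of two partial sums within 1 of f z *)
exists (2 + \sum_(n < N0) normc (t n)).
  by rewrite addr_ge0 // sumr_ge0 // => *; apply: normc_ge0.
move=> n; rewrite -tE; have [nN|nN] := ltnP n N0.
  rewrite (bigD1 (Ordinal nN)) //= addrCA lerDl addr_ge0 // sumr_ge0 // => *.
  exact: normc_ge0.
apply: (@le_trans _ _ 2); last by rewrite lerDl sumr_ge0 // => *; apply: normc_ge0.
have -> : t n = (f z - \sum_(k < n) t k) + - (f z - \sum_(k < n.+1) t k).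
  rewrite [X in - (_ - X)]big_ord_recr /= opprB.
  by move: (\sum_(_ < n) _) (t n) => s v; ring.
apply: le_trans (le_normcD (R := R) _ _) _; rewrite normcN.
have := H _ nN; have := H _ (leqW nN); rewrite -/(t _); lra.
Qed.

Lemma sum_geom_le (r : R) N : 0 <= r -> r < 1 ->
  \sum_(n < N) r ^+ n.+1 <= r / (1 - r).
Proof.
move=> r0 r1; rewrite ler_pdivlMr ?subr_gt0 //.
have -> : \sum_(n < N) r ^+ n.+1 = r * \sum_(n < N) r ^+ n.
  by rewrite mulr_sumr; apply: eq_bigr => i _; rewrite exprS.
rewrite -mulrA ler_piMr // mulrC -opprB mulNr -subrX1 opprB gerDl oppr_le0.
exact: exprn_ge0.
Qed.

(** The coefficient bound at height y0 / 2 leaves, above height y0, a geometric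
    series of ratio expR (- (w / 2) * Im z), where w = 2 pi / h; its sum from
    index 1 on is the decaying part of f. *)
Lemma fourier_decay f h u (y0 : R) : (0 < h)%N ->
  fourier_expansion f h u -> 0 < y0 ->
  exists C k : R, [/\ 0 <= C, 0 < k & forall z, y0 <= complex.Im z ->
    normc (f z - u 0%N) <= C * expR (- (k * complex.Im z))].
Proof.
move=> h0 fe y00.
pose w : R := 2 * pi / h%:R.
have w0 : 0 < w by rewrite divr_gt0 ?ltr0n // mulr_gt0 // pi_gt0.
have y02 : 0 < y0 / 2 by rewrite divr_gt0.
have [B B0 HB] := fourier_coef_bound fe y02.
pose r0 := expR (- (w / 2 * y0)).
have r01 : r0 < 1 by rewrite expR_lt1 oppr_lt0 mulr_gt0 // divr_gt0.
exists (B / (1 - r0)), (w / 2); split; [|by rewrite divr_gt0|].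
  by rewrite divr_ge0 // subr_ge0 ltW.
move=> z yz; set y := complex.Im z in yz *.
pose r := expR (- (w / 2 * y)).
have rr0 : r <= r0 by rewrite ler_expR lerN2 ler_pM2l // divr_gt0.
have r_ge0 : 0 <= r by exact: expR_ge0.
have r1 : r < 1 by apply: le_lt_trans r01.
pose t n := u n * cexp (twopii R * n%:R * z / h%:R).
have tB n : normc (t n) <= B * r ^+ n.
  rewrite /t normcM normc_fourier_term -/w -/y.
  have -> : expR (- (w * y)) = expR (- (w * (y0 / 2))) * expR (- (w * (y - y0 / 2))).
    by rewrite -expRD; congr expR; ring.
  rewrite exprMn (mulrA (normc _)); apply: ler_pM.
  - by rewrite mulr_ge0 ?normc_ge0 ?exprn_ge0 ?expR_ge0.
  - by rewrite exprn_ge0 ?expR_ge0.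
  - exact: HB.
  rewrite lerXn2r ?nnegrE ?expR_ge0 // ler_expR lerN2 -mulrA ler_pM2l //.
  by move: yz; lra.
have z0 : 0 < complex.Im z by apply: lt_le_trans yz.
apply/ler_addgt0Pr => e e0.
have [N0 H] := fourier_expansion_dist fe z0 e0.
have {H} := H N0.+1 (leqnSn _).
rewrite big_ord_recl /= mulr0 !mul0r cexp0 mulr1.
set S := \sum_(i < N0) _ => HS.
have -> : f z - u 0%N = S + (f z - (u 0%N + S)) by ring.
apply: le_trans (le_normcD (R := R) _ _) _; apply: lerD; last exact: ltW.
apply: le_trans (normc_sum _ _ _) _.
apply: (@le_trans _ _ (\sum_(i < N0) B * r ^+ i.+1)).
  by apply: ler_sum => i _; apply: tB.
rewrite -mulr_sumr -mulrA ler_wpM2l //.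
apply: le_trans (sum_geom_le _ r_ge0 r1) _.
rewrite mulrC -/y -/r ler_wpM2r // lef_pV2 ?posrE ?subr_gt0 //.
by rewrite lerD2l lerN2.
Qed.

Lemma expRN_le (x : R) : 0 < x -> expR (- x) <= x^-1.
Proof.
move=> x0; rewrite expRN lef_pV2 ?posrE ?expR_gt0 //.
by apply: le_trans (expR_ge1Dx x); rewrite lerDr.
Qed.

(** The constant term is the limit of f at i * infinity, whatever the period used
    for the expansion. *)
Lemma fourier_constant_eq f h u h' u' : (0 < h)%N -> (0 < h')%N ->
  fourier_expansion f h u -> fourier_expansion f h' u' -> u 0%N = u' 0%N.
Proof.
move=> h0 h0' fe fe'.
have [C [k [C0 k0 H]]] := fourier_decay h0 fe ltr01.
have [C' [k' [C0' k0' H']]] := fourier_decay h0' fe' ltr01.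
apply/eqP; rewrite -subr_eq0; apply/eqP/eq0_normc.
apply/eqP; rewrite eq_le normc_ge0 andbT; apply/ler_addgt0Pl => e e0; rewrite addr0.
pose D := C / k + C' / k'.
have D0 : 0 <= D by rewrite addr_ge0 // divr_ge0 // ltW.
(* high enough for the two decaying parts, at most D / y, to be below e *)
pose y := 1 + D / e; have De : 0 <= D / e by rewrite divr_ge0 // ltW.
have y1 : 1 <= y by rewrite lerDl.
have y0 : 0 < y by apply: lt_le_trans y1.
pose z : R[i] := 0 +i* y.
have -> : u 0%N - u' 0%N = (f z - u' 0%N) + - (f z - u 0%N) by ring.
apply: le_trans (le_normcD (R := R) _ _) _; rewrite normcN.
have bnd (c l : R) : 0 <= c -> 0 < l -> c * expR (- (l * y)) <= c / l / y.
  move=> c0 l0; rewrite -mulrA -invfM ler_wpM2l // expRN_le // mulr_gt0 //.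
apply: (@le_trans _ _ (C' / k' / y + C / k / y)).
  apply: lerD; first by apply: le_trans (H' z y1) _; apply: bnd.
  by apply: le_trans (H z y1) _; apply: bnd.
rewrite -mulrDl addrC -/D ler_pdivrMr // /y mulrDr mulr1 mulrCA divff ?gt_eqF // mulr1.
by rewrite lerDr ltW.
Qed.

(** With th = pi r / p in the open interval from 0 to pi, the real part is
    cos (2 th) = 1 - 2 (sin th)^2, and sin th is positive. *)
Lemma cexp_fraction_neq1 (p r : nat) : (0 < r < p)%N ->
  cexp (twopii R * r%:R / p%:R) != 1.
Proof.
move=> /andP[r0 rp].
have p0 : 0 < p%:R :> R by rewrite ltr0n (ltn_trans r0).
have := fourier_argE p r (1 : R[i]); rewrite mulr1 => ->.
apply/eqP => E; have {E} : complex.Re (cexp ((2 * pi * r%:R / p%:R)%:C *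
    (- complex.Im (1 : R[i]) +i* complex.Re (1 : R[i])))) = 1 by rewrite E.
pose th : R := pi * r%:R / p%:R.
have -> : (2 * pi * r%:R / p%:R : R) = th + th by rewrite /th; ring.
rewrite /cexp /=; simpc => /=; rewrite ?oppr0 ?mulr0 ?mulr1 expR0 mul1r cosD.
have s0 : 0 < sin th.
  apply: sin_gt0_pi; rewrite /th; apply/andP; split.
    by rewrite divr_gt0 // mulr_gt0 ?pi_gt0 // ltr0n.
  by rewrite ltr_pdivrMr // ltr_pM2l ?pi_gt0 // ltr_nat.
have := cos2Dsin2 th; move: (sin th) (cos th) s0 => s c; nra.
Qed.

Lemma sum_unity_roots (p n : nat) : (0 < p)%N -> ~~ (p %| n)%N ->
  \sum_(j < p) cexp (twopii R * n%:R * j%:R / p%:R) = 0.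
Proof.
move=> p0 pn; have pC : (p%:R : R[i]) != 0 by rewrite pnatr_eq0 -lt0n.
pose W := cexp (twopii R * n%:R / p%:R).
have -> : \sum_(j < p) cexp (twopii R * n%:R * j%:R / p%:R) = \sum_(j < p) W ^+ j.
  by apply: eq_bigr => j _; rewrite -cexpX; congr cexp; ring.
have W1 : W != 1.
  have -> : W = cexp (twopii R * (n %% p)%N%:R / p%:R).
    rewrite /W {1}(divn_eq n p).
    have -> : twopii R * (n %/ p * p + n %% p)%N%:R / p%:R =
      (n %/ p)%N%:R * twopii R + twopii R * (n %% p)%N%:R / p%:R.
      by rewrite natrD natrM; field.
    by rewrite cexpD cexpX cexp_twopii expr1n mul1r.
  by apply: cexp_fraction_neq1; rewrite lt0n ltn_mod p0 andbT.
have : (W - 1) * \sum_(j < p) W ^+ j = 0.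
  rewrite -subrX1 -cexpX.
  have -> : p%:R * (twopii R * n%:R / p%:R) = n%:R * twopii R by field.
  by rewrite cexpX cexp_twopii expr1n subrr.
by move/eqP; rewrite mulf_eq0 subr_eq0 (negbTE W1) => /eqP.
Qed.

Lemma Im_shift_div (p j : nat) z :
  complex.Im ((z + j%:R) / p%:R) = complex.Im z / p%:R.
Proof. by case: z => x y; rewrite !natr_complex -fmorphV /=; simpc. Qed.

(** Summing the n-th Fourier term over the p translates gives p times that term if
    p | n and 0 otherwise; so all terms disappear.  This is done on partial sums of
    a common length N, close enough to all p values of f. *)
Lemma sum_translates_eq0 f u (p : nat) z : (0 < p)%N ->
  fourier_expansion f 1 u -> (forall n, (p %| n)%N -> u n = 0) ->
  0 < complex.Im z -> \sum_(j < p) f ((z + j%:R) / p%:R) = 0.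
Proof.
move=> p0 fe up zi; have pC : (p%:R : R[i]) != 0 by rewrite pnatr_eq0 -lt0n.
have pR : 0 < p%:R :> R by rewrite ltr0n.
apply: eq0_normc; apply/eqP; rewrite eq_le normc_ge0 andbT.
apply/ler_addgt0Pl => e e0; rewrite addr0.
have zij j : 0 < complex.Im ((z + j%:R) / p%:R) by rewrite Im_shift_div divr_gt0.
have ep : 0 < e / p%:R by rewrite divr_gt0.
have /choice [Nf HN] j := fourier_expansion_dist fe (zij j) ep.
pose N := \max_(j < p) Nf j.
pose S (w : R[i]) := \sum_(n < N) u n * cexp (twopii R * n%:R * w / 1%:R).
have -> : \sum_(j < p) f ((z + j%:R) / p%:R) =
    \sum_(j < p) (f ((z + j%:R) / p%:R) - S ((z + j%:R) / p%:R)).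
  rewrite sumrB; suff -> : \sum_(j < p) S ((z + j%:R) / p%:R) = 0 by rewrite subr0.
  rewrite exchange_big big1 //= => n _; rewrite -mulr_sumr.
  have [pn|pn] := boolP (p %| n)%N; first by rewrite up // mul0r.
  have -> : \sum_(j < p) cexp (twopii R * n%:R * ((z + j%:R) / p%:R) / 1%:R) =
     cexp (twopii R * n%:R * z / p%:R) *
       \sum_(j < p) cexp (twopii R * n%:R * j%:R / p%:R).
    rewrite mulr_sumr; apply: eq_bigr => j _; rewrite -cexpD; congr cexp.
    by field.
  by rewrite sum_unity_roots // !mulr0.
apply: le_trans (normc_sum _ _ _) _.
apply: (@le_trans _ _ (\sum_(j < p) e / p%:R)).
  by apply: ler_sum => j _; apply/ltW/HN; apply: leq_bigmax.
by rewrite sumr_const card_ord -[_ *+ p]mulr_natr divfK ?gt_eqF.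
Qed.

(** * Integrals along vertical lines *)

(** A pointwise limit of finite sums of exponentials in t.  The factor c, taken as
    'i or 1, gives access to both components of the integrand. *)
Lemma measurable_fourier f h u (x : R) (c : R[i]) :
  fourier_expansion f h u ->
  measurable_fun (`]0, +oo[%classic : set R)
    (fun t : R => complex.Re (f (x +i* t) * c)).
Proof.
move=> fe.
pose g (N : nat) (t : R) := complex.Re
  ((\sum_(n < N) u n * cexp (twopii R * n%:R * (x +i* t) / h%:R)) * c).
apply: (@measurable_fun_cvg _ _ _ _ g) => //.
- move=> N; rewrite /g {g}.
  have -> : (fun t : R => complex.Re ((\sum_(n < N) u n *
        cexp (twopii R * n%:R * (x +i* t) / h%:R)) * c)) =
     (fun t : R => \sum_(n < N) expR (- (2 * pi * n%:R / h%:R) * t) *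
       complex.Re (u n * (cos (2 * pi * n%:R / h%:R * x)
           +i* sin (2 * pi * n%:R / h%:R * x)) * c)).
    apply/funext => t; rewrite mulr_suml Re_sum.
    apply: eq_bigr => n _; rewrite fourier_argE /cexp /=.
    case: (u n) => a b; case: c => c d; simpc => /=.
    by ring.
  apply: (@measurable_sum _ _ R _ _ (index_enum 'I_N)
    (fun n t => expR (- (2 * pi * n%:R / h%:R) * t) *
       complex.Re (u n * (cos (2 * pi * n%:R / h%:R * x)
           +i* sin (2 * pi * n%:R / h%:R * x)) * c))) => n.
  apply: measurable_funM; last exact: measurable_cst.
  apply: measurableT_comp; first exact: measurable_expR.
  by apply: measurable_funM.
move=> t /=; rewrite in_itv /= andbT => t0.
apply/cvgrPdist_lt => e e0.
have ec : 0 < e / (normc c + 1) by rewrite divr_gt0 // ltr_wpDl ?normc_ge0.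
have [N0 H] := fourier_expansion_dist fe (t0 : 0 < complex.Im (x +i* t)) ec.
exists N0 => // N /= NN; rewrite /g.
set S := \sum_(n < N) _.
have -> : complex.Re (f (x +i* t) * c) - complex.Re (S * c) =
  complex.Re ((f (x +i* t) - S) * c).
  by rewrite mulrBl; case: (_ * c) => ? ?; case: (S * c).
apply: le_lt_trans (normc_ge_absRe _) _; rewrite normcM.
apply: (@le_lt_trans _ _ (normc (f (x +i* t) - S) * (normc c + 1))).
  by rewrite ler_wpM2l ?normc_ge0 // lerDl.
by rewrite -ltr_pdivlMr ?ltr_wpDl ?normc_ge0 //; apply: H.
Qed.

Lemma slash_id f : slash f 1 0 0 1 = f.
Proof.
apply/funext => z; rewrite /slash /= mul1r mul0r add0r addr0 divr1.
by rewrite expr1n divr1.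
Qed.

Lemma slash_shift f z : slash f 1 1 0 1 z = f (z + 1).
Proof. by rewrite /slash /= mul1r mul0r add0r divr1 expr1n divr1. Qed.

(** The matrix (a b; c d) sends w = - d / c + i / (c^2 t) to a / c + i t, and
    c w + d = i / (c t), whose square is - 1 / (c t)^2. *)
Lemma slash_cusp f (a b c d : int) (t : R) : 0 < t -> c != 0 ->
  a * d - b * c = 1 ->
  f ((a%:~R / c%:~R) +i* t) =
  - slash f a b c d ((- d%:~R / c%:~R) +i* (c%:~R ^+ 2 * t)^-1)
    / ((c%:~R * c%:~R * t * t)%:C).
Proof.
move=> t0 c0 det; rewrite /slash.
have intC (n : int) : n%:~R = (n%:~R : R)%:C :> R[i] by rewrite rmorph_int.
have detR : a%:~R * d%:~R - b%:~R * c%:~R = 1 :> R.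
  by rewrite -!intrM -intrB det.
have cR : c%:~R != 0 :> R by rewrite intr_eq0.
have tn : t != 0 by rewrite gt_eqF.
rewrite !intC.
move: (a%:~R : R) (b%:~R : R) (c%:~R : R) (d%:~R : R) detR cR => A B C D detR cR.
set w := (- D / C) +i* (C ^+ 2 * t)^-1.
have den : C%:C * w + D%:C = 0 +i* (C * t)^-1.
  rewrite /w; simpc; congr (_ +i* _); by field; rewrite ?cR ?tn.
have num : A%:C * w + B%:C = (- C^-1) +i* (A / (C ^+ 2 * t)).
  rewrite /w; simpc; congr (_ +i* _).
  have -> : - (A * (D / C)) + B = - (A * D - B * C) / C by field.
  by rewrite detR; field.
have den0 : 0 +i* (C * t)^-1 != 0 :> R[i].
  by rewrite eq_complex /= eqxx /= invr_eq0 mulf_neq0.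
rewrite den num.
have -> : ((- C^-1) +i* (A / (C ^+ 2 * t))) / (0 +i* (C * t)^-1) = (A / C) +i* t.
  apply: (mulIf den0); rewrite divfK //; simpc; congr (_ +i* _); by field; rewrite ?cR ?tn.
have q0 : (C * C * t * t)%:C != 0 :> R[i].
  by rewrite eq_complex /= eqxx andbT !mulf_neq0.
have -> : (0 +i* (C * t)^-1) ^+ 2 = - ((C * C * t * t)%:C)^-1 :> R[i].
  apply: (mulIf q0); rewrite mulNr mulVf // expr2; simpc.
  apply/eqP; rewrite eq_complex /= ?oppr0 ?eqxx ?andbT; apply/eqP.
  by field; rewrite ?cR ?tn.
by rewrite invrN invrK mulrN opprK mulfK.
Qed.

Lemma sqr_expRN_le (x k : R) : 0 <= x -> 0 < k ->
  x ^+ 2 * expR (- (k * x)) <= 4 / k ^+ 2.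
Proof.
move=> x0 k0; rewrite expRN ler_pdivrMr ?expR_gt0 //.
have h : k * x / 2 <= expR (k * x / 2).
  by apply: le_trans (expR_ge1Dx _); rewrite lerDr.
have -> : expR (k * x) = expR (k * x / 2) ^+ 2.
  by rewrite expr2 -expRD; congr expR; field.
have kx : 0 <= k * x / 2 by rewrite divr_ge0 // mulr_ge0 // ltW.
apply: (@le_trans _ _ (4 / k ^+ 2 * (k * x / 2) ^+ 2)).
  by rewrite le_eqVlt; apply/orP; left; apply/eqP; field; rewrite gt_eqF.
rewrite ler_wpM2l //; first by rewrite divr_ge0 // sqr_ge0.
by rewrite lerXn2r ?nnegrE ?expR_ge0.
Qed.

(** Above height t0 = 1 / c^2, where c is the denominator of r, this is the
    expansion at infinity.  Below, [slash_cusp] moves the point to height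
    x = 1 / (c^2 t) >= 1, where the expansion of f | g decays faster than the
    automorphy factor c^2 x^2 grows; so f is bounded there, and a bound on a
    bounded interval is also of the form C * expR (- k t). *)
Lemma vertical_decay N f (r : rat) : cusp_form N f ->
  exists C k : R, [/\ 0 <= C, 0 < k & forall t : R, 0 < t ->
    normc (f (ratr r +i* t)) <= C * expR (- (k * t))].
Proof.
move=> [_ _ cusps].
have c0 := denq_gt0 r; have cn0 := denq_neq0 r.
pose c : R := (denq r)%:~R.
have cR : 0 < c by rewrite ltr0z.
pose t0 : R := (c ^+ 2)^-1.
have t00 : 0 < t0 by rewrite invr_gt0 exprn_gt0.
have [h [u [h0 u0]]] := cusps 1 0 0 1 erefl.
rewrite slash_id => fe.
have [C [k [C0 k0 HC]]] := fourier_decay h0 fe t00.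
have [b [d det]] : exists b d : int, numq r * d - b * denq r = 1.
  have [u1 [v1 E]] := Bezoutz (numq r) (denq r).
  have gcd1 : gcdz (numq r) (denq r) = 1.
    by rewrite /gcdz (eqP (coprime_num_den r)).
  by exists (- v1), u1; rewrite mulNr opprK (mulrC (numq r)) E gcd1.
have [h' [u' [h0' u0' fe']]] := cusps _ _ _ _ det.
have [C' [k' [C0' k0' HC']]] := fourier_decay h0' fe' ltr01.
pose M := C' * c ^+ 2 * (4 / k' ^+ 2).
have M0 : 0 <= M.
  by rewrite !mulr_ge0 ?invr_ge0 ?exprn_ge0 //; apply: ltW.
exists (C + M * expR (k * t0)), k; split => //.
  by rewrite addr_ge0 // mulr_ge0 ?expR_ge0.
move=> t tp; have [tt0|tt0] := leP t0 t.
  apply: (@le_trans _ _ (C * expR (- (k * t)))).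
    by have := HC (ratr r +i* t) tt0; rewrite u0 subr0.
  by rewrite ler_wpM2r ?expR_ge0 // lerDl mulr_ge0 ?expR_ge0.
apply: (@le_trans _ _ M); last first.
  rewrite mulrDl -mulrA -expRD.
  apply: (@le_trans _ _ (M * expR (k * t0 + - (k * t)))); last first.
    by rewrite lerDr mulr_ge0 ?expR_ge0.
  rewrite ler_peMr // -[X in X <= _]expR0 ler_expR -mulrBr mulr_ge0 ?subr_ge0 //.
    exact: ltW.
  exact: ltW.
have -> : ratr r = (numq r)%:~R / (denq r)%:~R :> R by [].
rewrite (slash_cusp f tp cn0 det) normcM normcN.
set w := _ +i* _.
pose x := (c ^+ 2 * t)^-1.
have x1 : 1 <= x.
  rewrite -[X in X <= _]invr1 lef_pV2 ?posrE ?mulr_gt0 ?exprn_gt0 //.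
  rewrite mulrC -ler_pdivlMr ?exprn_gt0 // mul1r.
  exact: ltW.
have := HC' w x1; rewrite u0' subr0 => Hw.
have -> : normc ((denq r)%:~R * (denq r)%:~R * t * t)%:C^-1 = c ^+ 2 * x ^+ 2.
  rewrite -fmorphV normcR ger0_norm; last first.
    by rewrite invr_ge0 !mulr_ge0 // ltW.
  by rewrite /x -/c; field; rewrite !gt_eqF.
apply: (@le_trans _ _ (C' * expR (- (k' * x)) * (c ^+ 2 * x ^+ 2))).
  by rewrite ler_wpM2r // mulr_ge0 ?sqr_ge0.
have -> : C' * expR (- (k' * x)) * (c ^+ 2 * x ^+ 2) =
  C' * c ^+ 2 * (x ^+ 2 * expR (- (k' * x))) by ring.
rewrite /M; apply: ler_wpM2l; first by rewrite mulr_ge0 // sqr_ge0.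
by apply: sqr_expRN_le => //; apply: le_trans x1.
Qed.

(** Domination by a multiple of the density of an exponential law, which is known
    to be integrable. *)
Lemma vertical_integrable N f (r : rat) (c : R[i]) : cusp_form N f ->
  (@lebesgue_measure R).-integrable `]0, +oo[%classic
    (EFin \o (fun t : R => complex.Re (f (ratr r +i* t) * c))).
Proof.
move=> cf; have [C [k [C0 k0 H]]] := vertical_decay r cf.
have [_ _ /(_ 1 0 0 1 erefl) [h [u [h0 u0]]]] := cf; rewrite slash_id => fe.
pose K := C * normc c / k.
have K0 : 0 <= K by rewrite divr_ge0 ?mulr_ge0 ?normc_ge0 // ltW.
have mD : measurable (`]0, +oo[%classic : set R) by exact: measurable_itv.
have ig : (@lebesgue_measure R).-integrable `]0, +oo[%classic
    (fun t : R => (K%:E * (exponential_pdf k t)%:E)%E).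
  apply: integrableZl => //.
  by have := integrable_exponential_pdf k0; apply: integrableS.
refine (@le_integrable _ _ R (@lebesgue_measure R) _ mD _ _ _ _ ig).
- apply/measurable_EFinP; exact: measurable_fourier fe.
- move=> t /=; rewrite in_itv /= andbT => t0.
  rewrite lee_fin exponential_pdfE; last exact: ltW.
  rewrite [X in _ <= X]ger0_norm; last first.
    by rewrite mulr_ge0 // mulr_ge0 ?expR_ge0 // ltW.
  apply: le_trans (normc_ge_absRe _) _; rewrite normcM.
  apply: (@le_trans _ _ (C * expR (- (k * t)) * normc c)).
    by rewrite ler_wpM2r ?normc_ge0 // H.
  rewrite /K mulNr le_eqVlt; apply/orP; left; apply/eqP.
  by field; rewrite gt_eqF.
Qed.

Local Notation mu := (@lebesgue_measure R).
Local Notation halfline := (`]0, +oo[%classic : set R).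

Lemma Rintegral_sum_eq0 n (F : nat -> R -> R) :
  (forall j, mu.-integrable halfline (EFin \o F j)) ->
  (forall t, 0 < t -> \sum_(j < n) F j t = 0) ->
  \sum_(j < n) Rintegral mu halfline (F j) = 0.
Proof.
move=> iF F0.
have mD : measurable halfline by exact: measurable_itv.
have : forall k, mu.-integrable halfline (EFin \o (fun t => \sum_(j < k) F j t)) /\
   \sum_(j < k) Rintegral mu halfline (F j) =
   Rintegral mu halfline (fun t => \sum_(j < k) F j t).
  elim=> [|k [ik IH]].
    have -> : (fun t : R => \sum_(j < 0) F j t) = (fun=> 0).
      by apply/funext => t; rewrite big_ord0.
    rewrite big_ord0; split; first exact: integrable0.
    by rewrite /Rintegral integral0.
  have -> : (fun t : R => \sum_(j < k.+1) F j t) =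
            (fun t => \sum_(j < k) F j t + F k t).
    by apply/funext => t; rewrite big_ord_recr.
  split; last by rewrite big_ord_recr /= IH RintegralD.
  by apply: (integrableD _ ik (iF k)); apply: measurable_itv.
move=> /(_ n) [_ ->].
have -> : Rintegral mu halfline (fun t => \sum_(j < n) F j t) =
          Rintegral mu halfline (fun=> 0).
  by apply: eq_Rintegral => t; rewrite inE /= in_itv /= andbT => /F0.
by rewrite /Rintegral integral0.
Qed.

(** Both components as real parts, since Im w = Re (w * - 'i) and the integrand is
    a multiple of 'i: one integrability statement then covers the two. *)
Lemma vertical_integralE f r : vertical_integral f r =
  Rintegral mu halfline (fun t => complex.Re (f (ratr r +i* t) * 'i%C)) +i*
  Rintegral mu halfline (fun t => complex.Re (f (ratr r +i* t) * 1)).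
Proof.
rewrite /vertical_integral /integralC; congr (_ +i* Rintegral _ _ _).
by apply/funext => t; rewrite ImiRe mulr1.
Qed.

(** At height t on the line through (r + j) / p, the point is (z + j) / p with
    z = r + i p t, so the integrands add up to 0 by [sum_translates_eq0]. *)
Lemma vertical_integral_sum_eq0 N f u (p : nat) (r : rat) : (0 < p)%N ->
  cusp_form N f -> fourier_expansion f 1 u ->
  (forall n, (p %| n)%N -> u n = 0) ->
  \sum_(j < p) vertical_integral f ((r + j%:R) / p%:R) = 0.
Proof.
move=> p0 cf fe up.
have main (c : R[i]) : \sum_(j < p) Rintegral mu halfline
     (fun t => complex.Re (f (ratr ((r + j%:R) / p%:R) +i* t) * c)) = 0.
  apply: (@Rintegral_sum_eq0 p (fun j t =>
     complex.Re (f (ratr ((r + j%:R) / p%:R) +i* t) * c))) => [j|t t0].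
    exact: vertical_integrable cf.
  have pR : (p%:R : R) != 0 by rewrite pnatr_eq0 -lt0n.
  rewrite -Re_sum -mulr_suml.
  have zi : 0 < complex.Im (ratr r +i* (p%:R * t) : R[i]).
    by rewrite mulr_gt0 // ltr0n.
  have <- : \sum_(j < p) f (((ratr r +i* (p%:R * t)) + j%:R) / p%:R) =
     \sum_(j < p) f (ratr ((r + j%:R) / p%:R) +i* t).
    apply: eq_bigr => j _; congr f.
    have -> : ratr ((r + j%:R) / p%:R) = (ratr r + j%:R) / p%:R :> R.
      by rewrite fmorph_div rmorphD /= !ratr_nat.
    rewrite !natr_complex -fmorphV /=; simpc; congr (_ +i* _).
    by field.
  by rewrite (sum_translates_eq0 p0 fe up zi) mul0r.
apply/eqP; rewrite eq_complex; apply/andP; split; apply/eqP.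
  rewrite Re_sum -[RHS](main 'i%C).
  by apply: eq_bigr => j _; rewrite vertical_integralE.
rewrite Im_sum -[RHS](main 1).
by apply: eq_bigr => j _; rewrite vertical_integralE.
Qed.

Lemma vertical_integral_shift N f (r : rat) : cusp_form N f ->
  vertical_integral f (r + 1) = vertical_integral f r.
Proof.
move=> [_ mod_f _]; rewrite !vertical_integralE.
have E t : 0 < t -> f (ratr (r + 1) +i* t) = f (ratr r +i* t).
  move=> t0; rewrite -(mod_f 1 1 0 1 _ _ (ratr r +i* t)) ?dvdz0 //.
  rewrite slash_shift rmorphD rmorph1; congr f.
  by apply/eqP; rewrite eq_complex /= addr0 !eqxx.
congr (_ +i* _); apply: eq_Rintegral => t; rewrite inE /= in_itv /= andbT => t0;
  by rewrite E.
Qed.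

End ComplexAnalysis.

(** * Additive reduction *)

Section Additive.
Variables (M : weierstrass int) (p : nat).
Hypotheses (p_prime : prime p) (add : additive_reduction M p).

Lemma additive_not_good : good_reduction M p = false.
Proof.
apply/negbTE/forallPn; have /existsP[P /andP[sP _]] := add.
by exists P; rewrite negbK.
Qed.

(** The Euler factor at p is the constant 1, so it has no term in p^-s. *)
Lemma additive_L_coef n : (0 < n)%N -> (p %| n)%N -> L_coef M n = 0.
Proof.
move=> n0 pn; have pp : p \in primes n by rewrite mem_primes p_prime n0.
rewrite /L_coef (big_rem p) //= /trace_of_frobenius additive_not_good add.
have : (0 < logn p n)%N by rewrite logn_gt0.
case: (logn p n) => // k _; rewrite /= mul0r.
by case: k => [|k]; rewrite ?mul0r ?subr0 ?mul0r.
Qed.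

(** Dirichlet series say nothing on the constant term, which is 0 by comparison
    with the expansion of f at the cusp infinity. *)
Lemma additive_fourier_vanish (R : realType) N (f : R[i] -> R[i]) :
  attached_form M N f ->
  exists2 u, fourier_expansion f 1 u & forall n, (p %| n)%N -> u n = 0.
Proof.
move=> [[_ _ cusps] _ [u [fe _ uL]]]; exists u => // n pn.
have [->|n0] := posnP n; last by rewrite uL // additive_L_coef // mulr0z.
have [h [v [h0 v0]]] := cusps 1 0 0 1 erefl.
by rewrite slash_id => /(fourier_constant_eq (isT : 0 < 1)%N h0 fe) ->.
Qed.

End Additive.

(** * Modular symbols *)

Section Symbols.
Variables (R : realType) (N p : nat) (f : R[i] -> R[i]).
Variables (phi : {freeg cusp} -> R[i]) (Omega : R[i]).
Hypotheses (cf : cusp_form N f) (ms : modular_symbol f phi).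

Definition symbol (s : rat) : R[i] :=
  phi (<< (None : cusp) >> - << (Some s : cusp) >>).

Lemma symbolE s : symbol s = twopii R * vertical_integral f s.
Proof. by rewrite /symbol ms.2. Qed.

Lemma symbol_shift s : symbol (s + 1) = symbol s.
Proof. by rewrite !symbolE (vertical_integral_shift _ cf). Qed.

Lemma symbol_sum_eq0 u (s : rat) : (0 < p)%N -> fourier_expansion f 1 u ->
  (forall n, (p %| n)%N -> u n = 0) ->
  \sum_(j < p) symbol ((s + j%:R) / p%:R) = 0.
Proof.
move=> p0 fe up; under eq_bigr => j _ do rewrite symbolE.
by rewrite -mulr_sumr (vertical_integral_sum_eq0 s p0 cf fe up) mulr0.
Qed.

(** iota fixes infinity and sends s to -s. *)
Lemma plus_symbol s : plus_part phi
    (<< (None : cusp) >> - << (Some s : cusp) >>) = (symbol s + symbol (- s)) / 2.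
Proof.
rewrite /plus_part /symbol; congr ((_ + phi _) / _).
by rewrite /iota_divisor lift_is_additive !liftU !scale1r.
Qed.

Lemma symbol_plus_rational s : cohomological_period p phi Omega ->
  exists x : rat, (symbol s + symbol (- s)) / 2 / Omega = ratr x
    /\ padic_abs p x <= 1.
Proof.
move=> [_ rat_phi _]; rewrite -plus_symbol.
have [|x xE xp] := rat_phi (<< (None : cusp) >> - << (Some s : cusp) >>); last by exists x.
by rewrite degB !degU subrr.
Qed.

End Symbols.

(** * Mazur-Tate elements *)

Section MazurTate.
Variables (R : realType) (p n : nat) (L : splittingFieldType rat) (zeta : L)
  (K : {subfield L}).
Hypotheses (p_prime : prime p) (n_gt0 : (1 <= n)%N).
Hypothesis cycl : cyclotomic_field (p ^ level p n) zeta.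
Hypothesis KnK : is_Kn p n zeta K.
Local Notation m := (level p n).
Local Notation q := (p ^ level p n)%N.
Local Notation rho a := (gal K (sigma zeta a)).
Local Notation P := (p ^ m.-1)%N.
Local Notation u := (1 + P)%N.

Lemma mazur_tateE phi (Omega : R[i]) g :
  mazur_tate p n zeta K phi Omega g =
  Omega^-1 * \sum_(a < q | coprime a p)
     symbol phi (a%:R / q%:R) * (g == rho a)%:R.
Proof.
rewrite /mazur_tate /gr_scale ffunE sum_ffunE; congr (_ * _).
by apply: eq_bigr => a _; rewrite !ffunE.
Qed.

(** Complex conjugation acts trivially on K. *)
Lemma rho_opp a : (0 < a < q)%N -> coprime a p -> rho (q - a) = rho a.
Proof.
move=> /andP[a0 aq] co; have [_ _ r1] := Kn_structure p_prime n_gt0 cycl KnK.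
have q1 : (1 < q)%N by lia.
have cq : coprime q.-1 p.
  rewrite -(coprime_level p n_gt0).
  by rewrite coprimePn // ltnW.
rewrite -[RHS]mul1g -r1 -(rho_mul K n_gt0 cycl) //; apply: (rho_mod K cycl).
have -> : (q.-1 * a = a.-1 * q + (q - a))%N.
  by move: q q1 aq {r1 cq} => Q Q1 aQ; nia.
by rewrite modnMDl.
Qed.

Lemma coprime_opp a : (a < q)%N -> coprime (q - a) p = coprime a p.
Proof.
move=> aq; rewrite ![coprime _ p]coprime_sym !prime_coprime //; congr (~~ _).
rewrite dvdn_subr ?(ltnW aq) // dvdn_exp //.
by rewrite ltnW // level_gt1.
Qed.

(** Reversal of the range from 1 to q - 1; the index 0, for which q - a would leave
    the range, is not coprime to p. *)
Lemma sum_coprime_opp (V : nmodType) (F : nat -> V) :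
  \sum_(a < q | coprime a p) F (q - a)%N = \sum_(a < q | coprime a p) F a.
Proof.
have q0 : (0 < q)%N by rewrite expn_gt0 prime_gt0.
have nc0 : coprime 0 p = false.
  by rewrite /coprime gcd0n gtn_eqF // prime_gt1.
have from1 (G : nat -> V) : \sum_(a < q | coprime a p) G a =
    \sum_(1 <= a < q | coprime a p) G a.
  by rewrite -(big_mkord (fun a => coprime a p)) big_ltn_cond // nc0.
rewrite (from1 (fun a => F (q - a)%N)) (from1 F) big_nat_rev /=.
rewrite big_nat_cond [RHS]big_nat_cond.
apply: eq_big => a; rewrite add1n subSS.
  by case: (boolP (1 <= a < q)%N) => //= /andP[a1 aq]; rewrite coprime_opp.
by move=> /andP[/andP[a1 aq] _]; rewrite subKn // ltnW.
Qed.

(** Both sides are 1 or 0 according to whether rho a lies in the coset g <[h]>. *)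
Lemma sum_rho_coset (h : gal_of K) g j a : #[h]%g = p ->
  \sum_(k < p) (g * h ^+ k == rho a * h ^+ j)%g%:R =
  \sum_(k < p) (g * h ^+ k == rho a)%g%:R :> R[i].
Proof.
move=> oh.
have E (F : gal_of K -> R[i]) : \sum_(k < p) F (h ^+ k)%g = \sum_(x in <[h]>%g) F x.
  by rewrite sum_cycle oh.
rewrite (E (fun x => (g * x == rho a * h ^+ j)%g%:R)).
rewrite (E (fun x => (g * x == rho a)%g%:R)).
rewrite (reindex_inj (mulIg (h ^+ j)%g)) /=.
apply: eq_big => x; first by rewrite groupMr // mem_cycle.
by move=> _; rewrite mulgA (inj_eq (mulIg _)).
Qed.

(** Group the a's as k + j P with k < P = p^(m-1).  The weight with which a enters
    the sum over a coset depends on k only, and the symbols at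
    (k + j P) / q = (k / P + j) / p add up to 0 over j. *)
Lemma mazur_tate_trace N (f : R[i] -> R[i]) phi (Omega : R[i]) v g :
  cusp_form N f -> modular_symbol f phi -> fourier_expansion f 1 v ->
  (forall k, (p %| k)%N -> v k = 0) ->
  \sum_(k < p) mazur_tate p n zeta K phi Omega (g * rho u ^+ k)%g = 0.
Proof.
move=> cf ms fe vp; have [_ oh _] := Kn_structure p_prime n_gt0 cycl KnK.
have p0 := prime_gt0 p_prime.
under eq_bigr => k _ do rewrite mazur_tateE.
rewrite -mulr_sumr; apply/eqP; rewrite mulf_eq0; apply/orP; right; apply/eqP.
rewrite exchange_big /=.
pose w a : R[i] := \sum_(k < p) (g * rho u ^+ k == rho a)%g%:R.
transitivity (\sum_(a < q | coprime a p) symbol phi (a%:R / q%:R) * w a).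
  by apply: eq_bigr => a _; rewrite mulr_sumr.
have m1 := level_gt1 p n_gt0.
have qE : q = (p * P)%N by rewrite -expnS; congr (_ ^ _)%N; lia.
have Pp : (p %| P)%N by rewrite dvdn_exp //; lia.
rewrite big_mkcond /=.
transitivity (\sum_(a < p * P) if coprime a p then symbol phi (a%:R / q%:R) * w a else 0).
  by rewrite -qE.
rewrite (sum_ord_mul p P (fun a => if coprime a p then symbol phi (a%:R / q%:R) * w a else 0)).
apply: big1 => k _.
have cop j : coprime (k + j * P) p = coprime k p.
  by rewrite ![coprime _ p]coprime_sym !prime_coprime // dvdn_addl // dvdn_mull.
have [ck|nck] := boolP (coprime k p); last first.
  by apply: big1 => j _; rewrite cop (negbTE nck).
transitivity (\sum_(j < p) symbol phi ((k%:R / P%:R + j%:R) / p%:R) * w k).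
  apply: eq_bigr => j _; rewrite cop ck; congr (symbol phi _ * _).
    rewrite qE natrD !natrM; field.
    by rewrite !pnatr_eq0 -!lt0n p0 expn_gt0 p0.
  have [e ->] : exists e, w (k + j * P)%N =
     \sum_(i < p) (g * rho u ^+ i == rho k * rho u ^+ e)%g%:R.
    have [e E] := rho_translate K p_prime n_gt0 cycl j ck.
    by exists e; rewrite /w E.
  exact: sum_rho_coset.
by rewrite -mulr_suml (symbol_sum_eq0 cf ms _ p0 fe vp) mul0r.
Qed.

(** Each coefficient is unchanged when a is replaced by q - a, and the symbol at
    (q - a) / q is the one at - a / q because f has period 1.  Averaging the two
    expressions leaves values of the plus part, to which the period applies. *)
Lemma mazur_tate_rational N (f : R[i] -> R[i]) phi (Omega : R[i]) :
  cusp_form N f -> modular_symbol f phi -> cohomological_period p phi Omega ->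
  exists theta : {ffun gal_of K -> rat},
    (forall g, mazur_tate p n zeta K phi Omega g = ratr (theta g)) /\
    (forall g, (0 <= ordp p (theta g))%E).
Proof.
move=> cf ms per.
have /choice [x xP] s := symbol_plus_rational s per.
exists [ffun g => \sum_(a < q | coprime a p) x (a%:R / q%:R) * (g == rho a)%:R].
split=> g; last first.
  rewrite ffunE; apply: ordp_ge_sum => // a _; case: eqP => _.
    by rewrite mulr1; apply: padic_abs_le1 => //; case: (xP (a%:R / q%:R)).
  by rewrite mulr0 ordp0 leey.
have q0 : (q%:R : rat) != 0 by rewrite pnatr_eq0 -lt0n expn_gt0 prime_gt0.
rewrite mazur_tateE [in RHS]ffunE rmorph_sum /=.
set S := \sum_(a < q | _) _.
have SE : S = \sum_(a < q | coprime a p) symbol phi (- (a%:R / q%:R)) * (g == rho a)%:R.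
  rewrite /S -(sum_coprime_opp (fun a => symbol phi (a%:R / q%:R) * (g == rho a)%:R)).
  apply: eq_bigr => a co.
  have a0 : (0 < a)%N.
    by rewrite lt0n; apply: contraTneq co => ->; rewrite /coprime gcd0n gtn_eqF // prime_gt1.
  rewrite rho_opp ?a0 ?ltn_ord //; congr (_ * _).
  rewrite -(symbol_shift cf ms (- _)) natrB; last exact: ltnW.
  congr symbol; move: (q%:R : rat) q0 => Q Q0; by field.
have -> : S = \sum_(a < q | coprime a p)
   ((symbol phi (a%:R / q%:R) + symbol phi (- (a%:R / q%:R))) / 2) * (g == rho a)%:R.
  transitivity ((S + S) / 2); first by field.
  rewrite {2}SE -big_split mulr_suml; apply: eq_bigr => a _ /=.
  by rewrite -mulrDl mulrAC.
rewrite mulr_sumr; apply: eq_bigr => a _.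
rewrite rmorphM /= ratr_nat -(xP _).1; ring.
Qed.

End MazurTate.

Theorem corollary5p3 (R : realType) (p : nat) (E : weierstrass rat)
    (M : weierstrass int) (N : nat) (f : R[i] -> R[i])
    (phi : {freeg cusp} -> R[i]) (Omega : R[i]) :
  prime p ->
  wdisc E != 0 ->
  global_minimal_model E M ->
  additive_reduction M p ->
  conductor M N ->
  attached_form M N f ->
  modular_symbol f phi ->
  cohomological_period p phi Omega ->
  forall (n : nat) (L : splittingFieldType rat) (zeta : L) (K : {subfield L}),
    (1 <= n)%N ->
    cyclotomic_field (p ^ level p n) zeta ->
    is_Kn p n zeta K ->
    exists theta : {ffun gal_of K -> rat},
      [/\ forall g, mazur_tate p n zeta K phi Omega g = ratr (theta g),
          forall g, (0 <= ordp p (theta g))%E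
        & forall gamma : gal_of K, generator [set: gal_of K]%SET gamma ->
            ((p ^ n.-1)%N%:Z%:E <= lambda_invariant p gamma theta)%E].
Proof.
move=> pp _ _ addM _ att ms per n L zeta K n1 cycl KnK.
have [cf _ _] := att.
have [theta [thE th0]] := mazur_tate_rational pp n1 cycl KnK cf ms per.
exists theta; split=> // gamma gen.
have [cG oh _] := Kn_structure pp n1 cycl KnK.
have [v fe vp] := additive_fourier_vanish pp addM att.
apply: (lambda_ge_of_trace0 pp gen _ oh); first by rewrite prednK.
move=> g; apply: (fmorph_inj (ratr : {rmorphism rat -> R[i]})).
rewrite rmorph_sum rmorph0 /=.
under eq_bigr => k _ do rewrite -thE.
exact: mazur_tate_trace cf ms fe vp.
Qed.
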